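(* Fix $\kappa > \kappa^*$. Let $\alpha = \kappa 2^k \log k / k$ and $m = \lfloor \alpha n \rfloor$. There exists $k^* = k^*(\kappa) > 0$ such that for any $k \ge k^*$ there exist $n^* > 0$, $\eta = \Omega_k(k^{-1})$, $\nu = \frac{1}{k^2 2^k}$, and constants $C_1, C_2 > 0$ (depending on $\kappa, k$) such that the following holds. If $n \ge n^*$, $\gamma \ge 1$, $1 \le D \le \frac{C_1 n}{\gamma \log n}$ and \[ \delta \le \exp(-C_2 \gamma D \log n), \] then there is no random degree-$D$ polynomial that $(\delta,\gamma,\eta,\nu)$-solves $\Phi_k(n,m)$.
   Context: Random $k$-SAT: variables $x_1,\dots,x_n$, literals $\mathcal{L}=\{x_1,\dots,x_n,\bar x_1,\dots,\bar x_n\}$. $\Omega_k(n,m)$ is the set of $k$-CNF formulas viewed as ordered $m$-tuples of clauses, each clause an ordered $k$-tuple of literals (repetitions allowed). $\Phi_k(n,m)$ is the uniform distribution on $\Omega_k(n,m)$, equivalently all $km$ literals $\Phi_{i,j}$ ($i\in[m]$, $j\in[k]$) are i.i.d. uniform on $\mathcal L$. An assignment $x\in\{\mathtt T,\mathtt F\}^n$ $\nu$-satisfies $\Phi$ if it satisfies at least $(1-\nu)m$ clauses. For $x,y\in\{\mathtt T,\mathtt F,\mathtt{err}\}^n$, $\Delta(x,y)=\frac1n|\{i:x_i\neq y_i\}|$; $x\in\{\mathtt T,\mathtt F,\mathtt{err}\}^n$ $(\eta,\nu)$-satisfies $\Phi$ if some $y\in\{\mathtt T,\mathtt F\}^n$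 with $\Delta(x,y)\le\eta$ $\nu$-satisfies $\Phi$. Constants: $\log$ is natural log; $\iota(\beta)=\frac{\beta}{1-\beta e^{-(\beta-1)}}$ on $(1,\infty)$ and $\kappa^*=\min_{\beta>1}\iota(\beta)\approx 4.911$. Encoding: fix a total order on $\mathcal L$; $\Phi$ is identified with the vector in $\{0,1\}^N$, $N=m\cdot k\cdot 2n$, of indicators $\Phi_{i,j,s}$ that $\Phi_{i,j}$ is the $s$-th literal. A degree-$D$ polynomial is $f:\mathbb R^N\to\mathbb R^n$ with each coordinate a real polynomial of degree $\le D$; a random degree-$D$ polynomial is $f:\mathbb R^N\times\Omega\to\mathbb R^n$ for some probability space $(\Omega,\mathbb P_\omega)$ with $f(\cdot,\omega)$ a degree-$D$ polynomial for each $\omega$. $\mathtt{round}:\mathbb R\to\{\mathtt T,\mathtt F,\mathtt{err}\}$ maps $x\ge1$ to $\mathtt T$, $x\le -1$ to $\mathtt F$, otherwise to $\mathtt{err}$ (applied coordinatewise). $f$ $(\delta,\gamma,\eta,\nu)$-solves $\Phi_k(n,m)$ if (a) $\mathbb P_{\Phi,\omega}[(\mathtt{round}\circ f)(\Phi,\omega)$ $(\eta,\nu)$-satisfies $\Phi]\ge 1-\delta$ and (b) $\mathbb E_{\Phi,\omega}\|f(\Phi,\omega)\|_2^2\le\gamma n$, where $\Phi\sim\Phi_k(n,m)$ independent of $\omega$. Notation: $\Omega_k(k^{-1})$ denotes a quantity independent of $n$ bounded below by $c/k$ for a constant $c>0$ as $k\to\infty$. *)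

(* Defs.v *)
From HB Require Import structures.
From mathcomp Require Import all_boot all_order all_algebra.
From mathcomp Require Import all_classical all_reals all_analysis.
From mathcomp Require Import lra.
(* The notations of mpoly clash with those of the analysis library. *)
From mathcomp Require mpoly.
Import (canonicals, coercions) mpoly.
Set Implicit Arguments.
Unset Strict Implicit.
Unset Printing Implicit Defensive.
Import Order.TTheory GRing.Theory Num.Theory.
Import numFieldNormedType.Exports.
Local Open Scope classical_set_scope.
Local Open Scope ring_scope.

Section Threshold.
Variable R : realType.

Definition iota_ksat (beta : R) : R := beta / (1 - beta * expR (- (beta - 1))).

(* The infimum is attained, see [kappa_starP]. *)
Definition kappa_star : R := inf [set iota_ksat beta | beta in `]1, +oo[].

Lemma iota_ksat_den (b : R) : 1 < b ->
  0 < 1 - b * expR (- (b - 1)) /\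
  1 - b * expR (- (b - 1)) < 1 /\
  1 - b * expR (- (b - 1)) <= (b - 1) ^+ 2.
Proof.
move=> b1; have e0 := expR_gt0 (- (b - 1)).
have e1 : b * expR (- (b - 1)) < 1.
  rewrite expRN ltr_pdivrMr ?expR_gt0// mul1r.
  by have := @expR_gt1Dx R (b - 1); rewrite subr_eq0 gt_eqF// addrC subrK; apply.
have e2 := @expR_ge1Dx R (- (b - 1)).
have be0 : 0 < b * expR (- (b - 1)) by nra.
split; first by lra.
by split; [lra|nra].
Qed.

Lemma iota_ksat_ge (b : R) : 1 < b -> b <= iota_ksat b.
Proof.
move=> b1; have [d0 [d1 _]] := iota_ksat_den b1.
by rewrite /iota_ksat ler_pdivlMr//; nra.
Qed.

Lemma kappa_starP : exists2 b : R, 1 < b & kappa_star = iota_ksat b /\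
  forall b', 1 < b' -> iota_ksat b <= iota_ksat b'.
Proof.
set M := iota_ksat 2.
have M2 : 2 <= M by apply: iota_ksat_ge; lra.
set a : R := 1 + M^-1.
have Mi0 : 0 < M^-1 by rewrite invr_gt0; lra.
have Mi1 : M * M^-1 = 1 by rewrite divff// gt_eqF//; lra.
have Mi2 : M^-1 <= 1 by nra.
have a1 : 1 < a by rewrite /a; lra.
have aM : a <= M by rewrite /a; lra.
have cf : {within `[a, M], continuous iota_ksat}.
  apply: continuous_in_subspaceT => x; rewrite inE/= in_itv/= => /andP[ax _].
  have x1 : 1 < x by lra.
  have [d0 _] := iota_ksat_den x1.
  apply: cvgM; first exact: cvg_id.
  apply: cvgV; first by rewrite gt_eqF.
  apply: cvgB; first exact: cvg_cst.
  apply: cvgM; first exact: cvg_id.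
  apply: (@continuous_comp _ _ _ (fun y : R => - (y - 1)) expR).
    by apply: cvgN; apply: cvgB; [exact: cvg_id|exact: cvg_cst].
  exact: continuous_expR.
have [c] := EVT_min aM cf; rewrite in_itv/= => /andP[ac cM] cmin.
have c1 : 1 < c by lra.
have cM2 : iota_ksat c <= M.
  by apply: cmin; rewrite in_itv/= M2 andbT /a; lra.
have cglob b' : 1 < b' -> iota_ksat c <= iota_ksat b'.
  move=> b1; have [b'M|Mb'] := leP b' M; last first.
    by apply: (le_trans cM2); apply: le_trans (iota_ksat_ge b1); exact: ltW.
  have [ab'|b'a] := leP a b'; first by apply: cmin; rewrite in_itv/= ab'.
  apply: (le_trans cM2); have [d0 [d1 d2]] := iota_ksat_den b1.
  rewrite [leRHS]/iota_ksat ler_pdivlMr//.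
  have h : b' - 1 <= M^-1 by rewrite /a in b'a; lra.
  have h2 : M * (b' - 1) <= 1 by rewrite -Mi1 ler_wpM2l//; lra.
  have h3 : M * (1 - b' * expR (- (b' - 1))) <= M * (b' - 1) ^+ 2.
    by rewrite ler_wpM2l//; lra.
  by apply: (le_trans h3); rewrite expr2 mulrA; nra.
exists c => //; split=> //; apply/eqP; rewrite eq_le; apply/andP; split.
  apply: ge_inf; last by exists c => //=; rewrite in_itv/= c1.
  exists (iota_ksat c) => _ /= [b' + <-].
  by rewrite in_itv/= andbT; exact: cglob.
apply: lb_le_inf; first by exists (iota_ksat c); exists c => //=; rewrite in_itv/= c1.
by move=> _ /= [b' + <-]; rewrite in_itv/= andbT; exact: cglob.
Qed.

End Threshold.
Arguments kappa_star R : clear implicits.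

Section Formulas.

(* [(i, true)] is the literal x_i and [(i, false)] its negation. *)
Definition literal (n : nat) : finType := ('I_n * bool)%type.

Definition formula (k n m : nat) : finType :=
  {ffun 'I_m -> {ffun 'I_k -> literal n}}.

Definition assignment (n : nat) : finType := {ffun 'I_n -> bool}.

(* [None] is the value err. *)
Definition err_assignment (n : nat) : finType := {ffun 'I_n -> option bool}.

Definition no_err n (y : assignment n) : err_assignment n :=
  [ffun i => Some (y i)].

Variables (R : realType) (k n m : nat).
Implicit Types (Phi : formula k n m) (x y : assignment n).

Definition sat_clause x (c : {ffun 'I_k -> literal n}) : bool :=
  [exists j : 'I_k, x (c j).1 == (c j).2].

Definition nu_satisfies (nu : R) x Phi : Prop :=
  (1 - nu) * m%:R <= #|[pred i : 'I_m | sat_clause x (Phi i)]|%:R.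

Definition Delta (x y : err_assignment n) : R :=
  #|[pred i : 'I_n | x i != y i]|%:R / n%:R.

Definition eta_nu_satisfies (eta nu : R) (x : err_assignment n) Phi : Prop :=
  exists2 y : assignment n, Delta x (no_err y) <= eta & nu_satisfies nu y Phi.

(* The pairs (position in the formula, literal); they are numbered by
   [enum_rank], whose choice fixes the order on the literals. *)
Definition slot : finType := ('I_m * 'I_k * literal n)%type.

Definition encode Phi : 'rV[R]_#|slot| :=
  \row_a let: (i, j, s) := enum_val a in (Phi i j == s)%:R.

Lemma card_slot : #|slot| = (m * k * (2 * n))%N.
Proof. by rewrite !card_prod !card_ord card_bool [(n * 2)%N]mulnC. Qed.

End Formulas.

Section Polynomials.
Variable R : realType.

(* [mpoly.msize p] is one plus the total degree of [p], and 0 if [p = 0]. *)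
Definition degree_poly N n (D : nat) (f : 'rV[R]_N -> 'rV[R]_n) : Prop :=
  forall i : 'I_n, exists2 p : mpoly.mpoly N R,
    (mpoly.msize p <= D.+1)%N &
    forall x : 'rV[R]_N, f x 0 i = mpoly.meval (fun a => x 0 a) p.

(* Measurability in the second variable, which is implicit in the notion of a
   random polynomial, gives a meaning to the probability and the expectation
   in [solves]. *)
Definition random_degree_poly d (T : measurableType d) N n (D : nat)
    (f : 'rV[R]_N -> T -> 'rV[R]_n) : Prop :=
  (forall w : T, degree_poly D (f^~ w)) /\
  (forall (x : 'rV[R]_N) (i : 'I_n),
     measurable_fun [set: T] (fun w => f x w 0 i)).

Definition round1 (x : R) : option bool :=
  if 1 <= x then Some true else if x <= -1 then Some false else None.

Definition round n (v : 'rV[R]_n) : err_assignment n :=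
  [ffun i => round1 (v 0 i)].

Definition sqnorm2 n (v : 'rV[R]_n) : R := \sum_(i < n) v 0 i ^+ 2.

End Polynomials.

Section Solves.
Local Open Scope ereal_scope.
Variables (R : realType) (d : measure_display) (T : measurableType d).
Variables (P : probability T R) (k n m : nat).

(* Probability and expectation with respect to the product of the uniform
   distribution on formulas and P; as the first factor is uniform on a finite
   type, they are averages over formulas. (The library product measure cannot
   be used as such: measurable types are pointed, and [formula k 0 m] is empty
   as soon as k and m are positive.) *)
Definition joint_prob (E : formula k n m -> set T) : \bar R :=
  (#|formula k n m|%:R^-1)%:E * \sum_(Phi : formula k n m) P (E Phi).

Definition joint_expectation (g : formula k n m -> T -> R) : \bar R :=
  (#|formula k n m|%:R^-1)%:E *
    \sum_(Phi : formula k n m) \int[P]_w (g Phi w)%:E.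

Definition solves (delta gamma eta nu : R)
    (f : 'rV[R]_#|slot k n m| -> T -> 'rV[R]_n) : Prop :=
  (1 - delta)%:E <=
    joint_prob (fun Phi =>
      [set w | eta_nu_satisfies eta nu (round (f (encode R Phi) w)) Phi])
  /\
  joint_expectation (fun Phi w => sqnorm2 (f (encode R Phi) w))
    <= (gamma * n%:R)%:E.

End Solves.

(* Main.v *)
Require Import Defs.
From HB Require Import structures.
From mathcomp Require Import all_boot all_order all_algebra.
From mathcomp Require Import all_classical all_reals all_analysis.
(* [all_analysis] does not export the measurable structure of [\bar R]. *)
From mathcomp Require Import measurable_realfun ring lra.
From mathcomp Require mpoly.
Import (canonicals, coercions) mpoly.
Set Implicit Arguments.
Unset Strict Implicit.
Unset Printing Implicit Defensive.
Import Order.TTheory GRing.Theory Num.Theory.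
Import numFieldNormedType.Exports.
Local Open Scope classical_set_scope.
Local Open Scope ring_scope.

(* Idea. Fixing a good seed, let Y map a formula to an assignment close to the
   rounded output of the polynomial. Resample the literals of a random formula
   one at a time, cyclically, for k rounds.

   Stability: the total influence of a degree-D polynomial is at most D times
   its second moment, so few steps are expected to move the output by more than
   4 c n / k. Comparing the path with the Metropolis chain that rejects those
   steps shows that none occurs with probability exp(- O(gamma D log n)).

   Obstruction: along a path without such jumps and without failure, one picks
   times one after the other so that the solution at each new time has
   conditional entropy about b log k / k given the previous ones. The entropy
   starts at 0, moves in small steps and is large once the formula has been
   fully resampled; the latter is a first moment bound, the previous solutions
   being independent of the new formula.

   First moment: there are about exp(n b log k) lists of k + 1 such
   assignments. Given that an assignment falsifies a clause, an earlier one
   falsifies its clause at the same position with probability at most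
   b exp(-(b - 1)) + o(1): a match on variables carrying information at least
   (1 + e) log k has probability at most k^-(1 + e) for each of the at most k
   earlier assignments, and carrying less information is a Chernoff event of
   Poisson type. Hence a clause is falsified by some assignment of the list with
   probability about k 2^-k (1 - b exp(-(b - 1))), and
   kappa (1 - b exp(-(b - 1))) > b makes such lists exponentially unlikely. *)

(** * Averages over finite types and survival of the resampling chain *)

Section Average.
Variable R : realType.

Definition avg (T : finType) (F : T -> R) : R := #|T|%:R^-1 * \sum_x F x.

Lemma eq_avg (T : finType) (F G : T -> R) : F =1 G -> avg F = avg G.
Proof. by move=> e; rewrite /avg; congr (_ * _); apply: eq_bigr => x _. Qed.

Lemma ler_avg (T : finType) (F G : T -> R) :
  (forall x, F x <= G x) -> avg F <= avg G.
Proof. by move=> e; rewrite ler_wpM2l ?invr_ge0//; apply: ler_sum. Qed.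

Lemma avg_ge0 (T : finType) (F : T -> R) : (forall x, 0 <= F x) -> 0 <= avg F.
Proof. by move=> e; rewrite mulr_ge0 ?invr_ge0// sumr_ge0. Qed.

Lemma avgD (T : finType) (F G : T -> R) :
  avg (fun x => F x + G x) = avg F + avg G.
Proof. by rewrite /avg big_split mulrDr. Qed.

Lemma avgB (T : finType) (F G : T -> R) :
  avg (fun x => F x - G x) = avg F - avg G.
Proof. by rewrite /avg sumrB mulrBr. Qed.

Lemma avgZ (T : finType) (a : R) (F : T -> R) :
  avg (fun x => a * F x) = a * avg F.
Proof. by rewrite /avg -mulr_sumr mulrCA. Qed.

Lemma avgZr (T : finType) (a : R) (F : T -> R) :
  avg (fun x => F x * a) = avg F * a.
Proof. by rewrite /avg -mulr_suml mulrA. Qed.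

Lemma avg_sum (T : finType) I (r : seq I) (Q : pred I) (F : I -> T -> R) :
  avg (fun x => \sum_(i <- r | Q i) F i x) = \sum_(i <- r | Q i) avg (F i).
Proof. by rewrite /avg exchange_big mulr_sumr. Qed.

Lemma avg_const (T : finType) (a : R) : (0 < #|T|)%N -> avg (fun _ : T => a) = a.
Proof.
move=> T0; rewrite /avg sumr_const -[X in _ * X]mulr_natl mulrA mulVf ?mul1r//.
by rewrite pnatr_eq0 -lt0n.
Qed.

Lemma avg_exchange (S T : finType) (F : S -> T -> R) :
  avg (fun x => avg (F x)) = avg (fun y => avg (F^~ y)).
Proof.
rewrite /avg -[in LHS]mulr_sumr exchange_big /= -[in RHS]mulr_sumr.
by rewrite mulrCA.
Qed.

Lemma avg_le_const (T : finType) (F : T -> R) (a : R) :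
  0 <= a -> (forall x, F x <= a) -> avg F <= a.
Proof.
move=> a0 Fa; have [T0|T0] := posnP #|T|.
  by rewrite /avg T0 invr0 mul0r.
by rewrite -[leRHS](avg_const _ T0); exact: ler_avg.
Qed.

Lemma avg_lt_ex (T : finType) (F G : T -> R) :
  avg F < avg G -> exists x, F x < G x.
Proof.
move=> lFG; apply: contrapT => /forallNP h; move: lFG; apply/negP.
by rewrite -leNgt; apply: ler_avg => x; rewrite leNgt; apply/negP.
Qed.

Lemma avg_pair (S T : finType) (F : S * T -> R) :
  avg F = avg (fun x => avg (fun y => F (x, y))).
Proof.
rewrite /avg -mulr_sumr mulrA card_prod natrM invfM; congr (_ * _).
by rewrite pair_bigA; apply: eq_bigr => -[].
Qed.

Lemma avg_bool (F : bool -> R) : avg F = 2^-1 * (F true + F false).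
Proof. by rewrite /avg card_bool big_bool. Qed.

Lemma avg_ffun_prod (I A : finType) (F : I -> A -> R) :
  avg (fun u : {ffun I -> A} => \prod_i F i (u i)) = \prod_i avg (F i).
Proof.
rewrite /avg big_split /= prodr_const card_ffun natrX exprVn.
by congr (_ * _); rewrite bigA_distr_bigA.
Qed.

(** The three lens laws say that [S] splits as [A] times a remainder; averages then need no explicit
    product decomposition. *)
Definition lens (S A : Type) (get : S -> A) (put : S -> A -> S) :=
  [/\ forall s a, get (put s a) = a, forall s, put s (get s) = s &
      forall s a b, put (put s a) b = put s b].

(** Exchanging the stored coordinate with the fresh value is an involution of [S * A]. Hence the
    states before and after resampling one coordinate form an exchangeable pair. *)
Lemma avg_swap (S A : finType) (get : S -> A) (put : S -> A -> S) :
  lens get put -> forall F : S -> S -> R,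
  avg (fun s => avg (fun a => F s (put s a))) =
  avg (fun s => avg (fun a => F (put s a) s)).
Proof.
move=> [gp pg pp] F.
rewrite -(avg_pair (fun sa => F sa.1 (put sa.1 sa.2))).
rewrite -(avg_pair (fun sa => F (put sa.1 sa.2) sa.1)) /avg; congr (_ * _).
pose h (sa : S * A) := (put sa.1 sa.2, get sa.1).
have hK : involutive h by move=> [s a]; rewrite /h/= gp pp pg.
rewrite (reindex_inj (inv_inj hK)); apply: eq_bigr => -[s a] _ /=.
by rewrite pp pg.
Qed.

Lemma avg_put (S A : finType) (get : S -> A) (put : S -> A -> S) :
  lens get put -> forall F : S -> R,
  avg (fun s => avg (fun a => F (put s a))) = avg F.
Proof.
move=> gp F; rewrite (avg_swap gp (fun _ => F)); apply: eq_avg => s.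
by rewrite avg_const//; apply/card_gt0P; exists (get s).
Qed.

Lemma avg_get (S A : finType) (get : S -> A) (put : S -> A -> S) :
  lens get put -> (0 < #|S|)%N -> forall F : A -> R,
  avg (fun s => F (get s)) = avg F.
Proof.
move=> gp S0 F; rewrite -(avg_put gp) -[RHS](avg_const _ S0).
by apply: eq_avg => s; apply: eq_avg => a; have [-> _ _] := gp.
Qed.

Lemma avg_gt0 (T : finType) (F : T -> R) :
  (0 < #|T|)%N -> (forall x, 0 < F x) -> 0 < avg F.
Proof.
move=> T0 F0; rewrite mulr_gt0 ?invr_gt0 ?ltr0n//.
have /card_gt0P[x _] := T0.
by rewrite (bigD1 x)//= ltr_wpDr// sumr_ge0// => y _; exact: ltW.
Qed.

Lemma avg_card (T : finType) (b : pred T) :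
  avg (fun x => (b x)%:R) = #|b|%:R / #|T|%:R.
Proof.
rewrite /avg mulrC -natr_sum -sum1_card [in RHS]big_mkcond /=.
by congr (_%:R / _); apply: eq_bigr => x _; rewrite unfold_in; case: (b x).
Qed.

Lemma ln_le_tangent (x y : R) : 0 < x -> 0 < y -> ln x <= x * y^-1 + ln y - 1.
Proof.
move=> x0 y0; have xy : 0 < x / y by rewrite divr_gt0.
have : -1 < x / y - 1 by lra.
move=> /le_ln1Dx; rewrite addrC subrK ln_div ?posrE//; lra.
Qed.

(** Jensen's inequality, from the tangent line of [ln] at the mean. *)
Lemma avg_ln_le (T : finType) (F : T -> R) :
  (0 < #|T|)%N -> (forall x, 0 < F x) -> avg (fun x => ln (F x)) <= ln (avg F).
Proof.
move=> T0 F0; have a0 := avg_gt0 T0 F0.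
apply: (@le_trans _ _ (avg (fun x => F x * (avg F)^-1 + (ln (avg F) - 1)))).
  by apply: ler_avg => x; rewrite addrA; exact: ln_le_tangent.
by rewrite avgD avgZr avg_const// divff ?gt_eqF//; lra.
Qed.

End Average.

(** * Survival probability of a chain resampling one coordinate at a time *)

Section Survive.
Variables (R : realType) (S A : finType) (P : Type).
Variables (get : P -> S -> A) (put : P -> S -> A -> S).
Hypothesis getputP : forall p, lens (get p) (put p).
Variable bad : rel S.
Hypotheses (bad_sym : symmetric bad) (bad_irr : irreflexive bad).
Hypothesis S_gt0 : (0 < #|S|)%N.

Fixpoint survive (ps : seq P) (u : S) : R :=
  if ps is p :: ps' then
    avg (fun a => (~~ bad u (put p u a))%:R * survive ps' (put p u a))
  else 1.

Definition bad_rate (p : P) : R :=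
  avg (fun u => avg (fun a => (bad u (put p u a))%:R)).

Let A_gt0 (p : P) : (0 < #|A|)%N.
Proof. by have /card_gt0P[s _] := S_gt0; apply/card_gt0P; exists (get p s). Qed.

Lemma survive_gt0 ps u : 0 < survive ps u.
Proof.
elim: ps u => [//|p ps IH] u /=; rewrite /avg mulr_gt0 ?invr_gt0 ?ltr0n ?(A_gt0 p)//.
have [_ pg _] := getputP p.
rewrite (bigD1 (get p u))//= pg bad_irr mul1r ltr_wpDr// sumr_ge0// => a _.
by rewrite mulr_ge0// ltW.
Qed.

(* Metropolis chain: a bad proposal is replaced by staying put, so that the
   uniform law stays invariant; Jensen's inequality is applied to it, the mass
   of the [w] rejected proposals being put back on the current state. *)
Lemma ln_survive_step p (g : S -> R) u : (forall v, 0 < g v) ->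
  avg (fun a => ln (g (if bad u (put p u a) then u else put p u a))) -
    2 * ln #|A|%:R * avg (fun a => (bad u (put p u a))%:R) <=
  ln (avg (fun a => (~~ bad u (put p u a))%:R * g (put p u a))).
Proof.
move=> g0; have [gp pg pp] := getputP p.
have A0 : 0 < #|A|%:R :> R by rewrite ltr0n (A_gt0 p).
pose b a := bad u (put p u a); pose w a := b a || (a == get p u).
have bg : b (get p u) = false by rewrite /b pg bad_irr.
have cw : #|w| = (1 + #|b|)%N.
  rewrite (cardD1 (get p u)) unfold_in /w eqxx orbT; congr (_ + _)%N.
  apply: eq_card => a; rewrite !inE unfold_in /w.
  by case: eqVneq => [->|ap]; [exact: esym bg|rewrite unfold_in /= (negbTE ap) orbF].
have w0 : 0 < #|w|%:R :> R by rewrite cw ltr0n.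
have avgb : avg (fun a => (b a)%:R) = #|b|%:R / #|A|%:R :> R.
  exact: avg_card.
(* [v] spreads the value [g u] of the null move [a = get p u] evenly over [w]: the mean is unchanged
   and all values become positive, as Jensen's inequality requires. *)
pose v a := if w a then g u / #|w|%:R else g (put p u a).
have v0 a : 0 < v a by rewrite /v; case: ifP => _//; rewrite divr_gt0.
have -> : avg (fun a => (~~ bad u (put p u a))%:R * g (put p u a)) = avg v.
  rewrite /avg; congr (_ * _).
  rewrite (bigID w)/= [RHS](bigID w)/=; congr (_ + _); last first.
    apply: eq_bigr => a nwa; rewrite /v (negbTE nwa).
    by move: nwa; rewrite /w negb_or => /andP[-> _]; rewrite mul1r.
  rewrite (bigD1 (get p u)) ?/w ?eqxx ?orbT//= pg bad_irr mul1r big1 ?addr0.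
    rewrite (eq_bigr (fun=> g u / #|w|%:R)); last by move=> a wa; rewrite /v ifT.
    by rewrite sumr_const -[RHS]mulr_natr divfK ?gt_eqF.
  by move=> a /andP[/orP[ba|/eqP ->]]; rewrite ?eqxx// -/(b a) ba mul0r.
apply: le_trans (avg_ln_le (A_gt0 p) v0).
have lnv a : ln (v a) = ln (g (if b a then u else put p u a))
                        - (w a)%:R * ln #|w|%:R.
  rewrite /v /w; case: (b a) => /=; first by rewrite ln_div ?posrE// mul1r.
  case: eqVneq => [->|_]; last by rewrite mul0r subr0.
  by rewrite pg ln_div ?posrE// mul1r.
rewrite (eq_avg lnv) avgB lerD2l lerN2 avgZr avgb.
have -> : avg (fun a => (w a)%:R) = #|w|%:R / #|A|%:R :> R.
  exact: avg_card.
(* The factor 2 comes from [1 + #|b| <= 2 * #|b|], so an empty [b] is treated apart; the loss is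
   then [ln 1 = 0]. *)
have [b0|b0] := posnP #|b|.
  by rewrite cw b0 ln1 mulr0 mul0r mulr0.
have lew : ln #|w|%:R <= ln #|A|%:R :> R.
  by rewrite ler_ln ?posrE// ler_nat max_card.
have le2 : #|w|%:R <= 2 * #|b|%:R :> R.
  by rewrite cw -natrM ler_nat mul2n -addnn leq_add2r.
have lw0 : 0 <= ln #|w|%:R :> R by rewrite ln_ge0// cw ler1n.
rewrite mulrAC [leRHS]mulrA ler_pM2r ?invr_gt0// [leRHS]mulrAC.
by apply: ler_pM.
Qed.

(** As [bad] is symmetric, the Metropolis chain is reversible for the uniform law. A step thus does
    not lower the mean of [ln (survive ps _)], and the losses of [ln_survive_step] add up. *)
Lemma avg_ln_survive ps :
  - (2 * ln #|A|%:R * \sum_(p <- ps) bad_rate p) <=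
  avg (fun u => ln (survive ps u)).
Proof.
elim: ps => [|p ps IH].
  by rewrite big_nil mulr0 oppr0 avg_ge0// => u; rewrite ln1.
have := ler_avg (fun u => ln_survive_step p u (survive_gt0 ps)).
apply: le_trans; rewrite avgB avgZ big_cons mulrDr opprD addrC lerD2r.
apply: (le_trans IH).
have -> : avg (fun u => avg (fun a =>
    ln (survive ps (if bad u (put p u a) then u else put p u a)))) =
  avg (fun u => avg (fun a => (~~ bad u (put p u a))%:R * ln (survive ps (put p u a)))) +
  avg (fun u => avg (fun a => (bad u (put p u a))%:R * ln (survive ps u))).
  rewrite -avgD; apply: eq_avg => u; rewrite -avgD; apply: eq_avg => a.
  by case: bad; rewrite !(mul1r, mul0r, addr0, add0r).
rewrite (avg_swap (getputP p) (fun u v => (~~ bad u v)%:R * ln (survive ps v))).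
rewrite -avgD; apply: ler_avg => u; rewrite -avgD -[leLHS](avg_const _ (A_gt0 p)).
apply: ler_avg => a; rewrite (bad_sym (put p u a)).
by case: bad; rewrite !(mul1r, mul0r, addr0, add0r).
Qed.

Lemma avg_survive_ge ps :
  expR (- (2 * ln #|A|%:R * \sum_(p <- ps) bad_rate p)) <= avg (survive ps).
Proof.
have s0 : 0 < avg (survive ps) by apply: avg_gt0 => // u; exact: survive_gt0.
rewrite -[leRHS]lnK ?posrE// ler_expR; apply: (le_trans (avg_ln_survive ps)).
by apply: avg_ln_le => // u; exact: survive_gt0.
Qed.

End Survive.

(** * Influences of low-degree functions *)

Section Influence.
Variables (R : realType) (S A : finType) (P : eqType).
Variables (get : P -> S -> A) (put : P -> S -> A -> S).
Hypothesis getputP : forall p, lens (get p) (put p).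
Hypothesis putC : forall p q, p != q -> forall s a b,
  put p (put q s b) a = put q (put p s a) b.

(** Conditional expectation given all coordinates but [p]. These operators are commuting orthogonal
    projections for [dot]: see [dot_mean_out], [mean_outK] and [mean_outC]. *)
Definition mean_out (p : P) (f : S -> R) (s : S) : R := avg (fun a => f (put p s a)).
Definition dot (f g : S -> R) : R := avg (fun s => f s * g s).
Definition ignores (p : P) (f : S -> R) := forall s a, f (put p s a) = f s.

Lemma dotC f g : dot f g = dot g f.
Proof. by apply: eq_avg => s; rewrite mulrC. Qed.

Lemma dotDr f g h : dot f (g \+ h) = dot f g + dot f h.
Proof. by rewrite -avgD; apply: eq_avg => s; rewrite /= mulrDr. Qed.

Lemma dotDl f g h : dot (f \+ g) h = dot f h + dot g h.
Proof. by rewrite dotC dotDr !(dotC h). Qed.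

Lemma dotBr f g h : dot f (g \- h) = dot f g - dot f h.
Proof. by rewrite -avgB; apply: eq_avg => s; rewrite /= mulrBr. Qed.

Lemma dot_ge0 f : 0 <= dot f f.
Proof. by apply: avg_ge0 => s; rewrite -expr2 sqr_ge0. Qed.

Lemma dot_mean_out p f g : dot (mean_out p f) g = dot f (mean_out p g).
Proof.
transitivity (avg (fun s => avg (fun a => f (put p s a) * g s))).
  by apply: eq_avg => s; rewrite avgZr.
rewrite -(avg_swap (getputP p) (fun s t => f s * g t)).
by apply: eq_avg => s; rewrite avgZ.
Qed.

Lemma mean_outD p f g : mean_out p (f \+ g) = mean_out p f \+ mean_out p g.
Proof. by apply/funext => s; rewrite /mean_out /= avgD. Qed.

Lemma mean_outB p f g : mean_out p (f \- g) = mean_out p f \- mean_out p g.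
Proof. by apply/funext => s; rewrite /mean_out /= avgB. Qed.

Lemma mean_out_sum p I (r : seq I) (g : I -> S -> R) :
  mean_out p (fun s => \sum_(i <- r) g i s) = fun s => \sum_(i <- r) mean_out p (g i) s.
Proof. by apply/funext => s; rewrite /mean_out avg_sum. Qed.

Lemma mean_outC p q f : mean_out p (mean_out q f) = mean_out q (mean_out p f).
Proof.
have [->//|pq] := eqVneq p q; apply/funext => s; rewrite /mean_out avg_exchange.
apply: eq_avg => a; apply: eq_avg => b; rewrite [in RHS]putC//.
Qed.

Lemma ignores_mean_out p f : ignores p (mean_out p f).
Proof.
by move=> s a; apply: eq_avg => b; have [_ _ ->] := getputP p.
Qed.

Lemma mean_out_id p f : ignores p f -> mean_out p f = f.
Proof.
move=> h; apply/funext => s; rewrite /mean_out (eq_avg (h s)) avg_const//.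
by apply/card_gt0P; exists (get p s).
Qed.

Lemma mean_outK p f : mean_out p (mean_out p f) = mean_out p f.
Proof. exact/mean_out_id/ignores_mean_out. Qed.

Lemma ignoresB p f g : ignores p f -> ignores p g -> ignores p (f \- g).
Proof. by move=> hf hg s a /=; rewrite hf hg. Qed.

Lemma ignores_mean_outC p q f : ignores p f -> ignores p (mean_out q f).
Proof.
have [->|pq] := eqVneq p q; first by move=> _; exact: ignores_mean_out.
by move=> h s a; apply: eq_avg => b; rewrite putC 1?eq_sym// h.
Qed.

Definition influence (p : P) (f : S -> R) : R := dot f (f \- mean_out p f).

Lemma influenceB p f : influence p f = dot f f - dot f (mean_out p f).
Proof. exact: dotBr. Qed.

(** On expanding the square, both square terms have the same mean because resampling preserves the
    uniform law, and the cross term is [dot f (mean_out p f)]. *)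
Lemma influenceE p f :
  avg (fun s => avg (fun a => (f s - f (put p s a)) ^+ 2)) = 2 * influence p f.
Proof.
transitivity (avg (fun s => f s ^+ 2 + mean_out p (fun s => f s ^+ 2) s
                           - 2 * (f s * mean_out p f s))).
  apply: eq_avg => s.
  have e : avg (fun a => (f s - f (put p s a)) ^+ 2) =
    avg (fun a => (f s ^+ 2 + f (put p s a) ^+ 2) - 2 * f s * f (put p s a)).
    by apply: eq_avg => a; ring.
  rewrite e avgB avgD avg_const; last by apply/card_gt0P; exists (get p s).
  by rewrite (avgZ (2 * f s)) /mean_out mulrA.
have e2 : avg (mean_out p (fun s => f s ^+ 2)) = avg (fun s => f s ^+ 2).
  exact: (avg_put (getputP p)).
rewrite avgB avgD (avgZ 2) e2 influenceB.
rewrite mulrBr; congr (_ - _).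
by rewrite mulr_natl mulr2n; congr (_ + _); apply: eq_avg => s; rewrite expr2.
Qed.

(* Induction on the coordinates: [f] splits orthogonally into [mean_out p f]
   and the rest, which has smaller degree in the remaining coordinates. *)
Lemma sum_influence_le (I : eqType) (ps : seq P) (D : nat) (r : seq I)
    (g : I -> S -> R) (J : I -> pred P) (f : S -> R) : uniq ps ->
  (forall i p, i \in r -> ~~ J i p -> ignores p (g i)) ->
  (forall i, i \in r -> (count (J i) ps <= D)%N) ->
  f = (fun s => \sum_(i <- r) g i s) ->
  \sum_(p <- ps) influence p f <= D%:R * dot f f.
Proof.
elim: ps D r g f => [|p ps IH] D r g f.
  by move=> _ _ _ _; rewrite big_nil mulr_ge0// dot_ge0.
move=> /= /andP[pps ups] ign deg fE; rewrite big_cons.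
pose f1 := mean_out p f; pose f2 := f \- f1.
have fD : f = f1 \+ f2 by apply/funext => s; rewrite /f2 /=; ring.
have o12 : dot f1 f2 = 0.
  rewrite /f1 dot_mean_out /f2 mean_outB /f1 mean_outK.
  by rewrite dotBr subrr.
have nf : dot f f = dot f1 f1 + dot f2 f2.
  by rewrite fD dotDr !(dotDl f1 f2) [dot f2 f1]dotC o12; ring.
have inf_p : influence p f = dot f2 f2.
  by rewrite /influence -/f1 -/f2 [in LHS]fD dotDl o12 add0r.
have inf_q q : influence q f = influence q f1 + influence q f2.
  have E : mean_out q f = mean_out q f1 \+ mean_out q f2 by rewrite -mean_outD -fD.
  have c12 : dot f1 (mean_out q f2) = 0.
    by rewrite /f1 dot_mean_out mean_outC {1}/f2 mean_outB mean_outK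
      mean_outB dotBr subrr.
  have c21 : dot f2 (mean_out q f1) = 0 by rewrite -dot_mean_out dotC.
  rewrite !influenceB E nf dotDr.
  rewrite [in dot f (mean_out q f1)]fD [in dot f (mean_out q f2)]fD.
  by rewrite !(dotDl f1 f2) c12 c21; ring.
have h1 : \sum_(q <- ps) influence q f1 <= D%:R * dot f1 f1.
  apply: (IH D r (fun i => mean_out p (g i))) => //.
  - by move=> i q ir nJ; apply: ignores_mean_outC; exact: ign.
  - by move=> i ir; apply: leq_trans (deg i ir); rewrite leq_addl.
  - by rewrite /f1 fE mean_out_sum.
(* Terms ignoring [p] cancel in [f2]; those left spend one unit of their degree on [p], so they have
   degree at most [D.-1] in [ps]. *)
pose r' := [seq i <- r | J i p].
have f2E : f2 = fun s => \sum_(i <- r') (g i \- mean_out p (g i)) s.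
  rewrite /f2 /f1 fE mean_out_sum; apply/funext => s /=.
  rewrite -sumrB big_filter [RHS]big_mkcond /= !big_seq; apply: eq_bigr => i ir.
  by case: ifPn => // nJ; rewrite (mean_out_id (ign _ _ ir nJ)) subrr.
(* For [D = 0] the predecessor would be wrong, but then no term depends on [p] and [f2] vanishes. *)
have [D0|D0] := posnP D.
  have r'0 : r' = [::].
    apply/eqP; rewrite -size_eq0 size_filter -leqn0 leqNgt -has_count.
    by apply/hasPn => i ir; have := deg i ir; rewrite D0 leqn0 addn_eq0 eqb0 => /andP[].
  have f20 : f2 = fun=> 0 by rewrite f2E r'0; apply/funext => s; rewrite big_nil.
  have d0 : dot f2 f2 = 0 by rewrite f20 /dot /avg big1 ?mulr0// => s _; rewrite mulr0.
  rewrite inf_p d0 add0r (eq_bigr (fun q => influence q f1 + influence q f2)); last by [].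
  rewrite big_split /= [X in _ + X]big1 ?addr0 ?nf ?d0 ?addr0// => q _.
  rewrite /influence f20 /dot /avg big1 ?mulr0// => s _; rewrite mul0r//.
have h2 : \sum_(q <- ps) influence q f2 <= D.-1%:R * dot f2 f2.
  apply: (IH D.-1 r' (fun i => g i \- mean_out p (g i))) => //.
  - move=> i q; rewrite mem_filter => /andP[Jp ir] nJ.
    by apply: ignoresB; [|apply: ignores_mean_outC]; exact: ign.
  - move=> i; rewrite mem_filter => /andP[Jp ir].
    by have := deg i ir; rewrite Jp add1n -(prednK D0) ltnS.
(* The influence of [p] is exactly [dot f2 f2], the unit missing between [D.-1] and [D] in the bound
   for [f2]. *)
rewrite inf_p (eq_bigr (fun q => influence q f1 + influence q f2)); last by [].
rewrite big_split /= nf mulrDr.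
move: h1; have -> : D%:R = 1 + D.-1%:R :> R by rewrite nat1r prednK.
by lra.
Qed.

End Influence.

(** * Empirical conditional entropy *)

Section Entropy.
Variables (R : realType) (V : finType).

Definition csize (X : eqType) (pat : V -> X) (v : V) : nat :=
  #|[pred u | pat u == pat v]|.

Definition joint (X Y : eqType) (pat : V -> X) (z : V -> Y) (v : V) : X * Y :=
  (pat v, z v).

(** Empirical conditional probability of the value [z v] given the class of [v], for a uniform
    point; [info] is the corresponding surprisal. *)
Definition cprob (X Y : eqType) (pat : V -> X) (z : V -> Y) (v : V) : R :=
  (csize (joint pat z) v)%:R / (csize pat v)%:R.

Definition info (X Y : eqType) (pat : V -> X) (z : V -> Y) (v : V) : R :=
  - ln (cprob pat z v).

(* The conditional entropy H(z(v) | pat(v)) for a uniformly random v. *)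
Definition centropy (X Y : eqType) (pat : V -> X) (z : V -> Y) : R :=
  avg (info pat z).

Lemma csize_gt0 (X : eqType) (pat : V -> X) v : (0 < csize pat v)%N.
Proof. by apply/card_gt0P; exists v; rewrite inE. Qed.

Lemma csizeE (X : eqType) (pat : V -> X) v :
  (csize pat v)%:R = \sum_u (pat u == pat v)%:R :> R.
Proof.
rewrite -natr_sum; congr (_%:R); rewrite /csize -sum1_card big_mkcond /=.
by apply: eq_bigr => u _; rewrite inE.
Qed.

Lemma csize_joint_le (X Y : eqType) (pat : V -> X) (z : V -> Y) v :
  (csize (joint pat z) v <= csize pat v)%N.
Proof. by apply: subset_leq_card; apply/fintype.subsetP => u; rewrite !inE => /andP[]. Qed.

Lemma cprob_gt0 (X Y : eqType) (pat : V -> X) (z : V -> Y) v : 0 < cprob pat z v.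
Proof. by rewrite divr_gt0// ltr0n csize_gt0. Qed.

Lemma cprob_le1 (X Y : eqType) (pat : V -> X) (z : V -> Y) v : cprob pat z v <= 1.
Proof.
by rewrite ler_pdivrMr ?ltr0n ?csize_gt0// mul1r ler_nat csize_joint_le.
Qed.

Lemma info_ge0 (X Y : eqType) (pat : V -> X) (z : V -> Y) v : 0 <= info pat z v.
Proof. by rewrite oppr_ge0 ln_le0// cprob_le1. Qed.

Lemma expR_info (X Y : eqType) (pat : V -> X) (z : V -> Y) v :
  expR (info pat z v) = (cprob pat z v)^-1.
Proof. by rewrite expRN lnK// posrE cprob_gt0. Qed.

Lemma eq_csize (X X' : eqType) (pat : V -> X) (pat' : V -> X') v :
  (forall u, (pat u == pat v) = (pat' u == pat' v)) -> csize pat v = csize pat' v.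
Proof. by move=> e; apply: eq_card => u; rewrite !inE. Qed.

Lemma eq_centropy (X X' Y : eqType) (pat : V -> X) (pat' : V -> X') (z : V -> Y) :
  (forall u v, (pat u == pat v) = (pat' u == pat' v)) ->
  centropy pat z = centropy pat' z.
Proof.
move=> e; apply: eq_avg => v; rewrite /info /cprob (eq_csize (e^~ v)).
congr (- ln (_%:R / _)); apply: eq_csize => u.
by rewrite /joint !xpair_eqE e.
Qed.

Lemma centropy0 (X Y : eqType) (pat : V -> X) (z : V -> Y) :
  (forall u v, pat u = pat v -> z u = z v) -> centropy pat z = 0.
Proof.
move=> e; rewrite /centropy /avg big1 ?mulr0// => v _.
rewrite /info /cprob (_ : csize _ v = csize pat v).
  by rewrite divff ?ln1 ?oppr0// pnatr_eq0 -lt0n csize_gt0.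
apply: eq_csize => u; rewrite /joint xpair_eqE.
by case: eqVneq => //= /e ->; rewrite eqxx.
Qed.

(** Given [pat], the pair of values of [z'] and [z] is at most as likely as the value of [z]
    alone. *)
Lemma info_chain (X Y Z : eqType) (pat : V -> X) (z' : V -> Y) (z : V -> Z) v :
  info pat z v <= info pat z' v + info (joint pat z') z v.
Proof.
rewrite /info -opprD lerN2 -lnM ?posrE ?cprob_gt0// ler_ln ?posrE ?cprob_gt0//; last first.
  by rewrite mulr_gt0 ?cprob_gt0.
rewrite /cprob mulrC mulrA divfK ?pnatr_eq0 -?lt0n ?csize_gt0//.
rewrite ler_wpM2r ?invr_ge0// ler_nat; apply: subset_leq_card.
by apply/fintype.subsetP => u; rewrite !inE /joint !xpair_eqE => /andP[/andP[-> _] ->].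
Qed.

(* Kraft's inequality, for the empirical law of [z] given [pat]. *)
Lemma sum_div_cprob (X : eqType) (Y : finType) (pat : V -> X) (z : V -> Y)
    (q : X -> Y -> R) : (forall x y, 0 <= q x y) ->
  avg (fun v => q (pat v) (z v) / cprob pat z v) <= avg (fun v => \sum_b q (pat v) b).
Proof.
move=> q0; rewrite /avg ler_wpM2l ?invr_ge0//.
rewrite (eq_bigr (fun v => \sum_u (pat u == pat v)%:R *
    (q (pat u) (z v) / (csize (joint pat z) v)%:R))); last first.
  move=> v _; rewrite /cprob invf_div mulrA mulrAC (csizeE pat) mulr_sumr.
  apply: eq_bigr => u _; case: eqVneq => [->|_]; first by rewrite mulr1 mul1r.
  by rewrite mulr0 mul0r.
rewrite exchange_big /=; apply: ler_sum => u _.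
rewrite (partition_big z xpredT)//=; apply: ler_sum => b _.
pose C := [pred v | (pat u == pat v) && (z v == b)].
rewrite (eq_bigr (fun v => if pat u == pat v then q (pat u) b / #|C|%:R else 0)); last first.
  move=> v /eqP zvb; case: eqVneq => [uv|_]; last by rewrite mul0r.
  rewrite mul1r zvb; congr (_ / _%:R); apply: eq_card => w.
  by rewrite !inE /joint xpair_eqE -uv zvb [pat w == _]eq_sym.
rewrite -big_mkcondr /= (eq_bigl (fun v => v \in C)); last first.
  by move=> v; rewrite !inE andbC.
rewrite sumr_const -[_ *+ _]mulr_natr; have [->|C0] := posnP #|C|.
  by rewrite mulr0.
by rewrite divfK// pnatr_eq0 -lt0n.
Qed.

(** Nonnegativity of relative entropy: the tangent inequality for [ln] at [cprob], averaged with
    Kraft's inequality. *)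
Lemma gibbs (X : eqType) (Y : finType) (pat : V -> X) (z : V -> Y)
    (q : X -> Y -> R) : (forall x y, 0 < q x y) -> (forall x, \sum_y q x y <= 1) ->
  centropy pat z <= avg (fun v => - ln (q (pat v) (z v))).
Proof.
move=> q0 q1; have [V0|V0] := posnP #|V|.
  by rewrite /centropy /avg V0 invr0 !mul0r.
have h : avg (fun v => q (pat v) (z v) / cprob pat z v) <= 1.
  apply: (le_trans (sum_div_cprob pat z (fun x y => ltW (q0 x y)))).
  by apply: avg_le_const.
apply: (@le_trans _ _ (avg (fun v => - ln (q (pat v) (z v)) +
    (q (pat v) (z v) / cprob pat z v - 1)))); last first.
  by rewrite avgD avgB (avg_const 1)//; lra.
apply: ler_avg => v; rewrite /info.
have := ln_le_tangent (q0 (pat v) (z v)) (cprob_gt0 pat z v).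
by lra.
Qed.

(** Above [tau], the excess is the logarithm of [expR (- tau) / cprob pat z v], which is smaller
    than its argument. *)
Lemma info_cap (X Y : eqType) (pat : V -> X) (z : V -> Y) (tau : R) v :
  info pat z v <= Num.min (info pat z v) tau + expR (- tau) / cprob pat z v.
Proof.
have c0 := cprob_gt0 pat z v.
have [_|h] := leP (info pat z v) tau.
  by rewrite lerDl divr_ge0 ?expR_ge0// ltW.
have p0 : 0 < expR (- tau) / cprob pat z v by rewrite divr_gt0// expR_gt0.
have := ln_sublinear p0; rewrite ln_div ?posrE ?expR_gt0// expRK /info; lra.
Qed.

Lemma avg_info_cap (X : eqType) (pat : V -> X) (z : V -> bool) (tau : R) :
  centropy pat z - 2 * expR (- tau) <= avg (fun v => Num.min (info pat z v) tau).
Proof.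
have := ler_avg (info_cap pat z tau); rewrite avgD -/(centropy pat z).
have := sum_div_cprob pat z (fun _ (_ : bool) => expR_ge0 (- tau)).
have : avg (fun v : V => \sum_(b : bool) expR (- tau)) <= 2 * expR (- tau).
  apply: avg_le_const; first by rewrite mulr_ge0 ?expR_ge0.
  by move=> _; rewrite big_bool mulr_natl mulr2n.
by lra.
Qed.

Lemma avg_expR_info (X : eqType) (pat : V -> X) (z : V -> bool) :
  avg (fun v => expR (info pat z v)) <= 2.
Proof.
have := sum_div_cprob pat z (fun _ (_ : bool) => @ler01 R).
rewrite (eq_avg (_ : _ =1 fun v => expR (info pat z v))); last first.
  by move=> v; rewrite expR_info mul1r.
by move/le_trans; apply; apply: avg_le_const => // _; rewrite big_bool.
Qed.

(** Kraft's inequality for the point mass at the value of [z'], which is a function of [pat]. This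
    bounds the chance of matching an earlier assignment by the information revealed. *)
Lemma avg_expR_info_match (X : eqType) (pat : V -> X) (z z' : V -> bool) :
  (forall u v, pat u = pat v -> z' u = z' v) ->
  avg (fun v => (z v == z' v)%:R * expR (info pat z v)) <= 1.
Proof.
move=> h; pose q (x : X) (b : bool) : R :=
  [exists v, (pat v == x) && (b == z' v)]%:R.
have qE v b : q (pat v) b = (b == z' v)%:R.
  rewrite /q; congr (nat_of_bool _)%:R; apply/existsP/idP => [[u /andP[/eqP /h ->]]//|bz].
  by exists v; rewrite eqxx.
have := @sum_div_cprob _ _ pat z q (fun _ _ => ler0n _ _).
rewrite (eq_avg (_ : _ =1 fun v => (z v == z' v)%:R * expR (info pat z v))); last first.
  by move=> v; rewrite expR_info qE.
move/le_trans; apply; apply: avg_le_const => // v.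
by rewrite big_bool !qE; case: (z' v); rewrite /= ?addr0 ?add0r.
Qed.

(** A Fano-type bound: by the chain rule it suffices to encode [z] given [z'], and Gibbs' inequality
    is applied to the guess [z = z'] with error probability [a]. *)
Lemma centropy_step (X : eqType) (pat : V -> X) (z z' : V -> bool) (a dlt : R) :
  0 < a -> a <= 2^-1 -> avg (fun v => (z v != z' v)%:R) <= dlt ->
  centropy pat z <= centropy pat z' + (dlt * - ln a + 2 * a).
Proof.
move=> a0 a2 hd; have la : 0 <= - ln a by rewrite oppr_ge0 ln_le0//; lra.
have := ler_avg (info_chain pat z' z).
rewrite avgD -/(centropy pat z) -/(centropy pat z') -/(centropy (joint pat z') z).
pose q (x : X * bool) (b : bool) : R := if b == x.2 then 1 - a else a.
have q0 x b : 0 < q x b by rewrite /q; case: ifP => _; lra.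
have q1 x : \sum_b q x b <= 1 by rewrite big_bool /q; case: x.2 => /=; lra.
have := gibbs (joint pat z') z q0 q1.
suff : avg (fun v => - ln (q (joint pat z' v) (z v))) <= dlt * - ln a + 2 * a by lra.
apply: (@le_trans _ _ (avg (fun v => (z v != z' v)%:R * - ln a + 2 * a))).
  apply: ler_avg => v; rewrite /q /=; case: eqVneq => _ /=; last by lra.
  rewrite mul0r add0r -lnV ?posrE; last by lra.
  have i0 : 0 < (1 - a)^-1 by rewrite invr_gt0; lra.
  have := ln_le_tangent i0 (@ltr01 R); rewrite ln1 invr1 mulr1.
  have : (1 - a)^-1 <= 1 + 2 * a.
    by rewrite -[leLHS]mul1r ler_pdivrMr; nra.
  by lra.
rewrite avgD (avgZr (- ln a)) lerD//; first by rewrite ler_wpM2r.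
by apply: avg_le_const => //; lra.
Qed.

(** Method of types. The type of [z] records its number of ones in each class of [pat]; the product
    law attached to a type has mass at most 1 and gives each [z] of that type the weight
    [expR (- (#|V| * centropy pat z))]. *)
Lemma count_centropy (X : finType) (pat : V -> X) (a : R) :
  \sum_(z : {ffun V -> bool}) ((centropy pat z <= a)%R)%:R <=
    (#|V|.+1%:R ^+ #|X|) * expR (#|V|%:R * a).
Proof.
pose N x := #|[pred u | pat u == x]|.
have NE v : N (pat v) = csize pat v by [].
pose ty (z : {ffun V -> bool}) : {ffun X -> 'I_#|V|.+1} :=
  [ffun x => inord #|[pred u | (pat u == x) && z u]|].
(* The minimum with the class size keeps [q] a probability law even for types [t] that no [z]
   realizes. *)
pose q (t : {ffun X -> 'I_#|V|.+1}) x (b : bool) : R :=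
  (if b then minn (t x) (N x) else N x - minn (t x) (N x))%N%:R / (N x)%:R.
have q0 t x b : 0 <= q t x b by rewrite /q divr_ge0.
have q1 t v : \sum_b q t (pat v) b = 1.
  rewrite big_bool /q /= -mulrDl -natrD subnKC ?geq_minr// divff//.
  by rewrite pnatr_eq0 -lt0n csize_gt0.
have qty z v : q (ty z) (pat v) (z v) = cprob pat z v.
  rewrite /q /cprob -NE; congr (_%:R / _).
  have le x : (#|[pred u | (pat u == x) && z u]| <= N x)%N.
    by apply: subset_leq_card; apply/fintype.subsetP => u; rewrite !inE => /andP[].
  rewrite ffunE inordK ?ltnS ?max_card// (minn_idPl (le _)) /csize.
  case: ifPn => zv.
    by apply: eq_card => u; rewrite !inE /joint xpair_eqE zv eqb_id.
  have -> : N (pat v) = (#|[pred u | (pat u == pat v) && z u]| +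
                         #|[pred u | (pat u == pat v) && ~~ z u]|)%N.
    rewrite /N -(cardID [pred u | z u]); congr (_ + _)%N; apply: eq_card => u; rewrite !inE.
    by rewrite andbC.
  rewrite addKn; apply: eq_card => u.
  by rewrite !inE /joint xpair_eqE (negbTE zv) eqbF_neg.
rewrite mulrC; apply: (@le_trans _ _ (expR (#|V|%:R * a) *
   \sum_(t : {ffun X -> 'I_#|V|.+1}) \sum_(z : {ffun V -> bool})
     \prod_v q t (pat v) (z v))); last first.
  rewrite ler_wpM2l ?expR_ge0// (eq_bigr (fun=> 1)); last first.
    move=> t _; rewrite -(bigA_distr_bigA (fun v b => q t (pat v) b)) big1//.
  by rewrite sumr_const card_ffun card_ord natrX.
rewrite exchange_big mulr_sumr; apply: ler_sum => z _ /=.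
have S0 : 0 <= \sum_t \prod_v q t (pat v) (z v).
  by apply: sumr_ge0 => t _; apply: prodr_ge0.
have [ca|_] := boolP (centropy pat z <= a); last exact: mulr_ge0 (expR_ge0 _) S0.
apply: (@le_trans _ _ (expR (#|V|%:R * a) * \prod_v q (ty z) (pat v) (z v))); last first.
  rewrite ler_wpM2l ?expR_ge0// (bigD1 (ty z))//= lerDl.
  by apply: sumr_ge0 => t _; apply: prodr_ge0.
rewrite (eq_bigr (fun v => expR (- info pat z v))); last first.
  by move=> v _; rewrite qty /info opprK lnK// posrE cprob_gt0.
rewrite -expR_sum -expRD -[leLHS]expR0 ler_expR sumrN subr_ge0.
have [V0|V0] := posnP #|V|.
  by rewrite V0 mul0r big1// => v; have := max_card (pred1 v); rewrite card1 V0.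
by rewrite mulrC -ler_pdivrMr ?ltr0n// mulrC.
Qed.

End Entropy.

(** * Falsified clauses *)

Section FfunLens.
Variables I A : finType.

Definition ffun_put (i : I) (f : {ffun I -> A}) (a : A) : {ffun I -> A} :=
  [ffun j => if j == i then a else f j].

Lemma ffun_putP i : lens (fun f : {ffun I -> A} => f i) (ffun_put i).
Proof.
split=> [f a|f|f a b]; first by rewrite ffunE eqxx.
  by apply/ffunP => j; rewrite ffunE; case: eqVneq => [->|].
by apply/ffunP => j; rewrite !ffunE; case: eqVneq.
Qed.

End FfunLens.
Arguments ffun_putP {I A} i.

Lemma natr_forall (R : realType) (I : finType) (b : pred I) :
  [forall i, b i]%:R = \prod_i (b i)%:R :> R.
Proof.
case: (altP forallP) => [h|/forallPn[i nbi]]; first by rewrite big1// => i _; rewrite h.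
by rewrite (bigD1 i)//= (negbTE nbi) mul0r.
Qed.

Lemma avg_ffun_two (R : realType) (I A : finType) (i j : I) (g h : A -> R) : i != j ->
  (0 < #|A|)%N ->
  avg (fun f : {ffun I -> A} => g (f i) * h (f j)) = avg g * avg h.
Proof.
move=> ij A0.
have F0 : (0 < #|{ffun I -> A}|)%N by rewrite card_ffun expn_gt0 A0.
rewrite -(avg_put (ffun_putP i)) -(avg_get (ffun_putP j) F0 h) -avgZ.
apply: eq_avg => f; rewrite -avgZr; apply: eq_avg => a.
by rewrite !ffunE eqxx eq_sym (negbTE ij).
Qed.

Lemma avg_literal (R : realType) (n : nat) (z : assignment n) (h : 'I_n -> R) :
  avg (fun l : literal n => (z l.1 != l.2)%:R * h l.1) = 2^-1 * avg h.
Proof.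
rewrite avg_pair -avgZ; apply: eq_avg => v /=; rewrite avg_bool.
by case: (z v); rewrite /= !(mul0r, mul1r, addr0, add0r).
Qed.

(** Convexity: on the unit interval the exponential lies below its chord. The two bounds inside
    compare the endpoints with the tangent at [x]. *)
Lemma expR_chord (R : realType) (mu x : R) : 0 <= x <= 1 ->
  expR (- mu * x) <= 1 - (1 - expR (- mu)) * x.
Proof.
move=> /andP[x0 x1]; set e := expR (- mu * x).
have e0 : 0 < e := expR_gt0 _.
have h1 : e * (1 + mu * x) <= 1.
  rewrite [leRHS](_ : 1 = e * expR (mu * x)); last by rewrite /e -expRD mulNr addNr expR0.
  by rewrite ler_pM2l// expR_ge1Dx.
have h2 : e * (1 + - (mu * (1 - x))) <= expR (- mu).
  have -> : expR (- mu) = e * expR (- (mu * (1 - x))).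
    by rewrite /e -expRD; congr expR; ring.
  by rewrite ler_pM2l// expR_ge1Dx.
have : (1 - x) * (e * (1 + mu * x)) <= (1 - x) * 1 by rewrite ler_wpM2l//; lra.
have : x * (e * (1 + - (mu * (1 - x)))) <= x * expR (- mu) by rewrite ler_wpM2l.
by lra.
Qed.

(** Exponential Markov inequality with parameter [theta], the [m] coordinates being independent. *)
Lemma chernoff_lower (R : realType) (A : finType) (m : nat) (B : 'I_m -> pred A)
    (q s theta : R) : 0 <= theta -> (forall i, q <= avg (fun a => (B i a)%:R)) ->
  avg (fun u : {ffun 'I_m -> A} => ((#|[pred i | B i (u i)]|%:R <= s)%R)%:R) <=
  expR (theta * s - m%:R * ((1 - expR (- theta)) * q)).
Proof.
(* For empty [A] the function space is empty, with average 0, except when [m = 0], where it has one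
   point. *)
move=> th0 hq; have [A0|A0] := posnP #|A|.
  have [m0|m0] := posnP m.
    rewrite [X in expR (_ - X)](_ : _ = 0) ?subr0; last by rewrite m0 mul0r.
    apply: avg_le_const; first exact: expR_ge0.
    move=> u; have [h|_] := boolP (_ <= s); last exact: expR_ge0.
    rewrite -[leLHS]expR0 ler_expR mulr_ge0//; exact: le_trans h.
  have F0 : #|{ffun 'I_m -> A}| = 0%N by rewrite card_ffun A0 card_ord exp0n.
  by rewrite {1}/avg F0 invr0 mul0r expR_ge0.
rewrite expRD.
apply: (@le_trans _ _ (avg (fun u : {ffun 'I_m -> A} =>
    expR (theta * s) * \prod_i expR (- (theta * (B i (u i))%:R))))).
  apply: ler_avg => u; rewrite -expR_sum -expRD sumrN -mulr_sumr -mulrBr.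
  have [h|_] := boolP (_ <= s); last exact: expR_ge0.
  rewrite -[leLHS]expR0 ler_expR mulr_ge0// subr_ge0; apply: le_trans h.
  rewrite -natr_sum ler_nat -sum1_card [in leqRHS]big_mkcond /=.
  by apply: leq_sum => i _; rewrite inE; case: (B i _).
rewrite avgZ ler_wpM2l ?expR_ge0//.
rewrite (avg_ffun_prod (fun i a => expR (- (theta * (B i a)%:R)))).
have -> : expR (- (m%:R * ((1 - expR (- theta)) * q))) =
    \prod_(i < m) expR (- ((1 - expR (- theta)) * q)).
  by rewrite prodr_const card_ord -mulrN expRM_natl.
apply: ler_prod => i _; rewrite avg_ge0 => [|a]; last exact: expR_ge0.
have t1 : 0 <= 1 - expR (- theta) by rewrite subr_ge0 expR_le1 oppr_le0.
apply: le_trans (expR_ge1Dx _).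
apply: (@le_trans _ _ (1 - (1 - expR (- theta)) * avg (fun a => (B i a)%:R))).
  rewrite -[X in X - _](avg_const _ A0) -avgZ -avgB; apply: ler_avg => a.
  by case: (B i a); rewrite /= ?mulr1 ?mulr0 ?oppr0 ?expR0 ?subr0//; lra.
by rewrite lerD2l lerN2 ler_wpM2l.
Qed.

Section Clause.
Variables (R : realType) (n k K : nat).
Hypothesis n_gt0 : (0 < n)%N.

(* [K] independent copies of the [k] literals of a clause; an entry [e] of a
   list pairs an assignment [e.1] with the choice [e.2 r] of the copy of the
   [r]-th literal it is tested on. *)
Definition clause_copies := {ffun 'I_k -> {ffun 'I_K -> literal n}}.
Definition entry := (assignment n * ('I_k -> 'I_K))%type.

Definition falsifies (e : entry) (W : clause_copies) : bool :=
  [forall r, e.1 (W r (e.2 r)).1 != (W r (e.2 r)).2].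

Definition past (zs : seq (assignment n)) (v : 'I_n) : seq bool :=
  [seq (z : assignment n) v | z <- zs].

Let lit_gt0 : (0 < #|literal n|)%N.
Proof. by rewrite card_prod card_ord card_bool muln_gt0 n_gt0. Qed.

Let col_gt0 : (0 < #|{ffun 'I_K -> literal n}|)%N.
Proof. by rewrite card_ffun expn_gt0 lit_gt0. Qed.

Let avg_const_half : avg (fun _ : 'I_n => 1) = 1 :> R.
Proof. by rewrite avg_const// card_ord. Qed.

(** A literal falsifies [e.1] with probability 1/2 whatever its variable. Given falsification, the
    [k] tested variables are therefore still independent and uniform. *)
Lemma avg_falsifies_weight (e : entry) (h : 'I_n -> R) :
  avg (fun W => (falsifies e W)%:R * \prod_r h (W r (e.2 r)).1) =
  2^-1 ^+ k * avg h ^+ k.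
Proof.
transitivity (avg (fun W : clause_copies =>
    \prod_r ((e.1 (W r (e.2 r)).1 != (W r (e.2 r)).2)%:R * h (W r (e.2 r)).1))).
  by apply: eq_avg => W; rewrite big_split natr_forall.
rewrite (avg_ffun_prod (fun r (c : {ffun 'I_K -> literal n}) =>
  (e.1 (c (e.2 r)).1 != (c (e.2 r)).2)%:R * h (c (e.2 r)).1)).
rewrite -exprMn -[in RHS](card_ord k) -prodr_const; apply: eq_bigr => r _.
rewrite -(avg_literal e.1).
exact: (avg_get (ffun_putP (e.2 r)) col_gt0
  (fun l : literal n => (e.1 l.1 != l.2)%:R * h l.1)).
Qed.

Lemma avg_falsifies (e : entry) :
  avg (fun W => (falsifies e W)%:R) = 2^-1 ^+ k :> R.
Proof.
have := avg_falsifies_weight e (fun=> 1); rewrite avg_const_half expr1n mulr1 => <-.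
by apply: eq_avg => W; rewrite big1// mulr1.
Qed.

(** Each literal contributes at most 1/2. On a shared copy both assignments must agree, and
    [avg_expR_info_match] applies; on distinct copies the additional 1/2 from [e'] pays for the
    bound 2 of [avg_expR_info]. *)
Lemma avg_falsifies_two (X : eqType) (pat : 'I_n -> X) (e e' : entry) (tau : R) :
  (forall u v, pat u = pat v -> e'.1 u = e'.1 v) ->
  avg (fun W => (falsifies e W)%:R * (falsifies e' W)%:R *
    \prod_r expR (Num.min (info R pat e.1 (W r (e.2 r)).1) tau)) <= 2^-1 ^+ k.
Proof.
move=> det; pose h v := expR (Num.min (info R pat e.1 v) tau).
have h0 v : 0 <= h v by exact: expR_ge0.
have hi v : h v <= expR (info R pat e.1 v) by rewrite ler_expR ge_min lexx.
pose F r (c : {ffun 'I_K -> literal n}) : R :=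
  (e.1 (c (e.2 r)).1 != (c (e.2 r)).2)%:R * (e'.1 (c (e'.2 r)).1 != (c (e'.2 r)).2)%:R
  * h (c (e.2 r)).1.
rewrite (eq_avg (_ : _ =1 fun W : clause_copies => \prod_r F r (W r))); last first.
  by move=> W; rewrite !big_split !natr_forall.
rewrite (avg_ffun_prod F) -[in leRHS](card_ord k) -prodr_const.
apply: ler_prod => r _; rewrite avg_ge0 /=; last by move=> c; rewrite !mulr_ge0.
have [c12|c12] := eqVneq (e.2 r) (e'.2 r).
  have -> : avg (F r) = avg (fun l : literal n =>
      (e.1 l.1 != l.2)%:R * ((e.1 l.1 == e'.1 l.1)%:R * h l.1)).
    rewrite -(avg_get (ffun_putP (e.2 r)) col_gt0); apply: eq_avg => c.
    rewrite /F -c12 -mulrA.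
    by case: (e.1 _); case: (e'.1 _); case: (_.2); rewrite /= ?mul0r ?mul1r.
  rewrite (avg_literal e.1 (fun v => (e.1 v == e'.1 v)%:R * h v)).
  rewrite ger_pMr ?invr_gt0//; apply: le_trans (avg_expR_info_match R e.1 det).
  by apply: ler_avg => v; rewrite ler_wpM2l.
have -> : avg (F r) = avg (fun l : literal n => (e.1 l.1 != l.2)%:R * h l.1) *
    avg (fun l : literal n => (e'.1 l.1 != l.2)%:R * 1).
  rewrite -(avg_ffun_two _ _ c12 lit_gt0); apply: eq_avg => c.
  by rewrite /F mulr1 mulrAC.
rewrite (avg_literal e.1 h) (avg_literal e'.1 (fun=> 1)) avg_const_half mulr1.
have : avg h <= 2.
  by apply: le_trans (avg_expR_info R pat e.1); exact: ler_avg.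
by lra.
Qed.

Definition some_falsified (w : seq entry) (W : clause_copies) : bool :=
  has (falsifies^~ W) w.

(* If [e] and some [e'] in [w] are both falsified, then either the total
   information of [e.1] on the variables of the clause is at most [tau], or the
   match with [e'] is less likely than [expR (- tau)]. *)
Lemma avg_falsifies_again (e : entry) (w : seq entry) (mu tau : R) :
  0 <= mu -> 0 < tau ->
  avg (fun W => (falsifies e W && some_falsified w W)%:R) <=
  2^-1 ^+ k * (expR (mu - (1 - expR (- mu)) * k%:R *
      ((centropy R (past (unzip1 w)) e.1 - 2 * expR (- tau)) / tau)) +
    (size w)%:R * expR (- tau)).
Proof.
move=> mu0 tau0; pose pat := past (unzip1 w).
pose psi v := Num.min (info R pat e.1 v) tau.
have psi0 v : 0 <= psi v by rewrite le_min info_ge0 ltW.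
have psi1 v : psi v <= tau by rewrite ge_min lexx orbT.
apply: (@le_trans _ _ (avg (fun W =>
   expR mu * ((falsifies e W)%:R * \prod_r expR (- mu * (psi (W r (e.2 r)).1 / tau))) +
   expR (- tau) * \sum_(e' <- w) ((falsifies e W)%:R * (falsifies e' W)%:R *
      \prod_r expR (psi (W r (e.2 r)).1))))).
  apply: ler_avg => W; rewrite -!expR_sum -!mulr_sumr -!mulr_suml.
  rewrite -mulr_sumr.
  set L := \sum_(r < k) psi (W r (e.2 r)).1.
  case: (falsifies e W); last by rewrite /= !(mul0r, mulr0) addr0.
  rewrite /= !mul1r; have [hs|_] := boolP (some_falsified w W); last first.
    by rewrite addr_ge0 ?mulr_ge0 ?expR_ge0// sumr_ge0.
  rewrite -[leLHS]/(1 : R); set S := \sum_(e' <- w) _.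
  have S1 : 1 <= S.
    move: hs => /hasP[e' e'w fe']; rewrite /S (big_rem e')//= fe' lerDl.
    by rewrite sumr_ge0.
  have t1 : 0 < expR mu * expR (- mu * (L / tau)) by rewrite mulr_gt0 ?expR_gt0.
  have t2 : 0 <= expR (- tau) * (S * expR L).
    by rewrite !mulr_ge0 ?expR_ge0//; lra.
  have [Lt|Lt] := leP L tau.
    have : 1 <= expR mu * expR (- mu * (L / tau)).
      rewrite -expRD -[leLHS]expR0 ler_expR.
      have : L / tau <= 1 by rewrite ler_pdivrMr// mul1r.
      by nra.
    by lra.
  have : 1 <= expR (- tau) * (S * expR L).
    rewrite mulrCA -[leLHS]mul1r ler_pM// -expRD -[leLHS]expR0 ler_expR; lra.
  by lra.
rewrite avgD (avgZ (expR mu)) (avgZ (expR (- tau))) avg_sum mulrDr lerD//; last first.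
  rewrite mulrA [leRHS]mulrC ler_wpM2l ?expR_ge0//.
  rewrite [leRHS](_ : _ = \sum_(e' <- w) 2^-1 ^+ k); last first.
    by rewrite big_const_seq count_predT iter_addr_0 mulr_natr.
  rewrite !big_seq; apply: ler_sum => e' e'w; apply: avg_falsifies_two => u v uv.
  have /(nthP e')[i iw <-] := e'w.
  have := congr1 (fun s => nth false s i) uv.
  by rewrite /past !(nth_map e'.1) ?size_map// (nth_map e').
rewrite (avg_falsifies_weight e (fun v => expR (- mu * (psi v / tau)))).
rewrite mulrCA ler_wpM2l ?exprn_ge0 ?invr_ge0//.
rewrite [leRHS]expRD ler_wpM2l ?expR_ge0//.
have m1 : 0 <= 1 - expR (- mu) by rewrite subr_ge0 expR_le1 oppr_le0.
apply: (@le_trans _ _ (expR (- ((1 - expR (- mu)) *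
    ((centropy R pat e.1 - 2 * expR (- tau)) / tau))) ^+ k)); last first.
  by rewrite -expRM_natl ler_expR; lra.
apply: lerXn2r; rewrite ?nnegrE ?expR_ge0//.
  by apply: avg_ge0 => v; exact: expR_ge0.
apply: le_trans (expR_ge1Dx _).
apply: (@le_trans _ _ (1 - (1 - expR (- mu)) * (avg psi / tau))).
  rewrite -[X in X - _]avg_const_half -avgZr -avgZ -avgB; apply: ler_avg => v.
  by apply: expR_chord; rewrite ler_pdivrMr// mul1r psi1 divr_ge0// ltW.
rewrite lerD2l lerN2; apply: ler_wpM2l => //; apply: ler_wpM2r.
  by rewrite invr_ge0 ltW.
exact: avg_info_cap.
Qed.

(** Lists are in reverse order of choice: an assignment is conditioned on those behind it, and the
    last one, chosen first, is unconstrained. *)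
Fixpoint entropies_in (lo hi : R) (zs : seq (assignment n)) : bool :=
  if zs is z :: zs' then
    ((zs' == [::]) || (lo <= centropy R (past zs') z <= hi)) && entropies_in lo hi zs'
  else true.

(** Inclusion-exclusion along the list: a new entry adds [2^-1 ^+ k] minus its overlap with the
    earlier ones, hence at least [2^-1 ^+ k * xi]. The oldest entry is given away, whence the
    predecessor of [size w]. *)
Lemma avg_some_falsified (w : seq entry) (lo hi mu tau xi : R) (N : nat) :
  0 <= mu -> 0 < tau -> (size w <= N.+1)%N -> entropies_in lo hi (unzip1 w) ->
  xi + expR (mu - (1 - expR (- mu)) * k%:R * ((lo - 2 * expR (- tau)) / tau)) +
    N%:R * expR (- tau) <= 1 ->
  (size w).-1%:R * (2^-1 ^+ k * xi) <= avg (fun W => (some_falsified w W)%:R).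
Proof.
move=> mu0 tau0 sw ent hxi; elim: w sw ent => [|e w IH] /=.
  by move=> _ _; rewrite mul0r avg_ge0.
rewrite ltnS => sw /andP[lohi ent].
have [w0|w0] := posnP (size w).
  by rewrite w0 mul0r avg_ge0.
have {}lohi : lo <= centropy R (past (unzip1 w)) e.1.
  by move: lohi; rewrite -size_eq0 size_map eqn0Ngt w0 /= => /andP[].
have := IH (leqW sw) ent; have := avg_falsifies_again e w mu0 tau0.
have -> : avg (fun W => (some_falsified (e :: w) W)%:R) = 2^-1 ^+ k +
    avg (fun W => (some_falsified w W)%:R) -
    avg (fun W => (falsifies e W && some_falsified w W)%:R) :> R.
  rewrite -(avg_falsifies e) -avgD -avgB; apply: eq_avg => W /=.
  by case: (falsifies e W); case: (some_falsified w W); rewrite /= ?subr0 ?addr0 ?add0r ?addrK.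
have p0 : 0 < 2^-1 ^+ k :> R by rewrite exprn_gt0// invr_gt0.
set A := avg _; set B := avg _; set p := 2^-1 ^+ k in p0 *.
have m1 : 0 <= 1 - expR (- mu) by rewrite subr_ge0 expR_le1 oppr_le0.
set E := expR (mu - _) + _ => hA hB.
have hE : xi + E <= 1.
  apply: le_trans hxi; rewrite -addrA lerD2l lerD//; last first.
    by rewrite ler_wpM2r ?expR_ge0// ler_nat.
  rewrite ler_expR lerD2l lerN2 ler_wpM2l//; first by rewrite mulr_ge0.
  by apply: ler_wpM2r; [rewrite invr_ge0 ltW|lra].
have : p * E <= p * (1 - xi) by rewrite ler_pM2l//; lra.
move: hB; rewrite -{2}(prednK w0) -natr1 => hB.
have : ((size w).-1%:R + 1) * (p * xi) = (size w).-1%:R * (p * xi) + p * xi by ring.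
by lra.
Qed.

End Clause.

(** * The resampling path *)

Section Path.
Variables (R : realType) (n k m : nat).
Hypothesis n_gt0 : (0 < n)%N.
Variable p0 : 'I_m * 'I_k.

(** All the randomness of the path, drawn in advance: copy [j] of a position is its literal after
    [j] resamplings, with [j] from 0 to [k]. *)
Definition sample := {ffun 'I_m -> clause_copies n k k.+1}.
Let pos := ('I_m * 'I_k)%type.
Let N := #|{: pos}|.

Let N_gt0 : (0 < N)%N.
Proof. by apply/card_gt0P; exists p0. Qed.

Definition fput (p : pos) (F : formula k n m) (l : literal n) : formula k n m :=
  [ffun i => [ffun r => if (i, r) == p then l else F i r]].

Lemma fputP p : lens (fun F : formula k n m => F p.1 p.2) (fput p).
Proof.
split=> [F l|F|F l l'].
- by rewrite !ffunE -surjective_pairing eqxx.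
- by apply/ffunP => i; apply/ffunP => r; rewrite !ffunE; case: eqVneq => [<-|].
- by apply/ffunP => i; apply/ffunP => r; rewrite !ffunE; case: eqVneq.
Qed.

Lemma fputC p q : p != q -> forall F l l',
  fput p (fput q F l') l = fput q (fput p F l) l'.
Proof.
move=> pq F l l'; apply/ffunP => i; apply/ffunP => r; rewrite !ffunE.
by case: eqVneq => [->|//]; rewrite (negbTE pq).
Qed.

Definition select (c : pos -> nat) (U : sample) : formula k n m :=
  [ffun i => [ffun r => U i r (inord (c (i, r)))]].

Definition select_put (c : pos -> nat) (U : sample) (F : formula k n m) : sample :=
  [ffun i => [ffun r => [ffun j =>
    if j == inord (c (i, r)) then F i r else U i r j]]].

Lemma selectP c : lens (select c) (select_put c).
Proof.
split=> [U F|U|U F F'].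
- by apply/ffunP => i; apply/ffunP => r; rewrite !ffunE eqxx.
- apply/ffunP => i; apply/ffunP => r; apply/ffunP => j; rewrite !ffunE.
  by case: eqVneq => [->|].
- apply/ffunP => i; apply/ffunP => r; apply/ffunP => j; rewrite !ffunE.
  by case: eqVneq.
Qed.

Definition lit_put (p : pos) (c : nat) (U : sample) (l : literal n) : sample :=
  [ffun i => [ffun r => [ffun j =>
    if ((i, r) == p) && (j == inord c) then l else U i r j]]].

Lemma lit_putP p c : lens (fun U : sample => U p.1 p.2 (inord c)) (lit_put p c).
Proof.
split=> [U l|U|U l l'].
- by rewrite !ffunE -surjective_pairing !eqxx.
- apply/ffunP => i; apply/ffunP => r; apply/ffunP => j; rewrite !ffunE.
  by case: eqVneq => [<-/=|//]; case: eqVneq => [->|].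
- apply/ffunP => i; apply/ffunP => r; apply/ffunP => j; rewrite !ffunE.
  by case: (_ && _).
Qed.

Lemma sample_gt0 : (0 < #|sample|)%N.
Proof.
do 3![rewrite card_ffun expn_gt0; apply/orP; left].
by rewrite card_prod card_ord card_bool muln_gt0 n_gt0.
Qed.

Definition step (t : nat) : pos := nth p0 (enum {: pos}) (t %% N).

(* The number of times position [p] is resampled in the first [t] steps of the
   cyclic resampling. *)
Definition copy (t : nat) (p : pos) : nat :=
  ((t + (N.-1 - index p (enum {: pos}))) %/ N)%N.

Definition state (t : nat) : sample -> formula k n m := select (copy t).

Lemma copyS t p : copy t.+1 p = (copy t p + (p == step t))%N.
Proof.
set r := index p (enum {: pos}).
have rN : (r < N)%N by rewrite /N cardE index_mem mem_enum.
rewrite /copy -/r addSn divnS// addnC; congr (_ + nat_of_bool _)%N.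
(* The quotient by [N] increases exactly when [N] divides [t + (N - r)], that is when [t] is
   congruent to the rank [r] of [p]. *)
have -> : (t + (N.-1 - r)).+1 = (t + (N - r))%N.
  by rewrite -addnS -subSn ?prednK// -ltnS prednK.
have -> : (N %| t + (N - r))%N = (t == r %[mod N]).
  rewrite -(eqn_modDr (N - r)) [X in _ == X %[mod N]]subnKC ?(ltnW rN)//.
  by rewrite modnn.
rewrite (modn_small rN) /step; apply/eqP/eqP => [->|h].
  by rewrite nth_index// mem_enum.
by rewrite /r h index_uniq ?enum_uniq// -cardE ltn_mod.
Qed.

Lemma copy_mono s t p : (s <= t)%N -> (copy s p <= copy t p)%N.
Proof. by move=> st; rewrite leq_div2r// leq_add2r. Qed.

Lemma copyD t p : copy (t + N) p = (copy t p).+1.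
Proof. by rewrite /copy addnAC divnDr// divnn N_gt0 addn1. Qed.

Lemma copy_le t p : (t <= k * N)%N -> (copy t p <= k)%N.
Proof.
move=> tk; rewrite -ltnS ltn_divLR// mulSnr -addnS leq_add//.
by rewrite (leq_ltn_trans (leq_subr _ _))// prednK.
Qed.

Lemma inord_eq (a b : nat) : (a <= k)%N -> (b <= k)%N ->
  (inord a == inord b :> 'I_k.+1) = (a == b).
Proof. by move=> ak bk; rewrite -val_eqE /= !inordK. Qed.

Lemma stateS t U : (t < k * N)%N ->
  state t.+1 U =
  fput (step t) (state t U) (U (step t).1 (step t).2 (inord (copy t (step t)).+1)).
Proof.
move=> tk; apply/ffunP => i; apply/ffunP => r; rewrite !ffunE copyS.
by case: eqVneq => [<-|_]; rewrite ?addn1 ?addn0.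
Qed.

(** Step [t] reads a copy with a larger index than any used at its position up to time [t], so
    earlier states do not see it. *)
Lemma state_lit_put s t U l : (t < k * N)%N -> (s <= t)%N ->
  state s (lit_put (step t) (copy t (step t)).+1 U l) = state s U.
Proof.
move=> tk st; apply/ffunP => i; apply/ffunP => r; rewrite !ffunE.
case: eqVneq => [->|//] /=.
have := copy_mono (step t) st; have := copy_le (step t) tk.
rewrite copyS eqxx addn1 => c1 c2.
rewrite inord_eq// ?(leq_trans c2 (ltnW c1))//.
by rewrite ltn_eqF.
Qed.

Section Survival.
Variable bad : rel (formula k n m).

Definition good_until (t : nat) (U : sample) : bool :=
  [forall s : 'I_t, ~~ bad (state s U) (state s.+1 U)].

Lemma good_untilS t U :
  good_until t.+1 U = good_until t U && ~~ bad (state t U) (state t.+1 U).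
Proof.
apply/forallP/andP => [h|[/forallP h1 h2] s].
  split; last exact: (h ord_max).
  by apply/forallP => s; exact: (h (widen_ord (leqnSn t) s)).
have [->//|st] := eqVneq (s : nat) t.
have lt : (s < t)%N by rewrite ltn_neqAle st -ltnS ltn_ord.
exact: (h1 (Ordinal lt)).
Qed.

(** Identifies the explicit path with the chain of [survive]: integrating the fresh literal of step
    [t] moves one step from [survive] into [good_until]. *)
Lemma avg_good_survive j t : (t + j <= k * N)%N ->
  avg (fun U => (good_until t U)%:R *
    survive R fput bad [seq step s | s <- iota t j] (state t U)) =
  avg (fun U => (good_until (t + j) U)%:R).
Proof.
elim: j t => [|j IH] t tj /=.
  by rewrite addn0; apply: eq_avg => U; rewrite mulr1.
rewrite -addSnnS -IH ?addSnnS//.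
have tk : (t < k * N)%N by apply: leq_trans tj; rewrite -addSnnS leq_addr.
rewrite -[RHS](avg_put (lit_putP (step t) (copy t (step t)).+1)).
apply: eq_avg => U; rewrite -avgZ; apply: eq_avg => l.
have -> : state t.+1 (lit_put (step t) (copy t (step t)).+1 U l) =
    fput (step t) (state t U) l.
  rewrite stateS// (state_lit_put _ _ tk)//; congr (fput _ _ _).
  by have [-> _ _] := lit_putP (step t) (copy t (step t)).+1.
rewrite good_untilS stateS// !(state_lit_put _ _ tk)//.
have -> : good_until t (lit_put (step t) (copy t (step t)).+1 U l) = good_until t U.
  apply: eq_forallb => s; rewrite !(state_lit_put _ _ tk)//.
  exact: ltnW.
have [-> _ _] := lit_putP (step t) (copy t (step t)).+1.
by case: good_until; rewrite /= ?mul0r ?mul1r.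
Qed.

Lemma sum_step (b : pos -> R) :
  \sum_(p <- [seq step s | s <- iota 0 (k * N)]) b p = k%:R * \sum_p b p.
Proof.
suff h j : \sum_(p <- [seq step s | s <- iota 0 (j * N)]) b p = j%:R * \sum_p b p by [].
elim: j => [|j IH]; first by rewrite mul0n big_nil mul0r.
rewrite mulSnr iotaD map_cat big_cat IH /= add0n -natr1 mulrDl mul1r; congr (_ + _).
rewrite -[(j * N)%N]addn0 iotaDl -map_comp big_map /=.
rewrite -[RHS]big_enum /= -[X in _ = \sum_(i <- X) b i](mkseq_nth p0) [RHS]big_map -cardE -/N.
rewrite !big_seq; apply: eq_bigr => s; rewrite mem_iota /= add0n => sN.
by rewrite /step modnMDl modn_small.
Qed.

Hypotheses (bad_sym : symmetric bad) (bad_irr : irreflexive bad).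

Lemma avg_good_ge :
  expR (- (2 * ln #|literal n|%:R *
    (k%:R * \sum_p bad_rate R fput bad p))) <=
  avg (fun U => (good_until (k * N) U)%:R).
Proof.
have F0 : (0 < #|formula k n m|)%N.
  do 2![rewrite card_ffun expn_gt0; apply/orP; left].
  by rewrite card_prod card_ord card_bool muln_gt0 n_gt0.
have := @avg_good_survive (k * N) 0 (leqnn _); rewrite add0n => <-.
have -> : avg (fun U => (good_until 0 U)%:R * survive R fput bad
    [seq step s | s <- iota 0 (k * N)] (state 0 U)) =
    avg (survive R fput bad [seq step s | s <- iota 0 (k * N)]).
  rewrite -(avg_get (selectP (copy 0)) sample_gt0); apply: eq_avg => U.
  rewrite (_ : good_until 0 U) ?mul1r//; apply/forallP => -[] //.
rewrite -(sum_step (bad_rate R fput bad)).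
exact: (avg_survive_ge R fputP bad_sym bad_irr F0).
Qed.

End Survival.

(** In [N] steps every position advances to a new copy, so the state at time [t + N] is uniform and
    independent of all states up to time [t]. *)
Lemma avg_fresh (t : nat) (ts : seq nat)
    (H : seq (formula k n m) -> formula k n m -> R) :
  (t + N <= k * N)%N -> all (fun s => (s <= t)%N) ts ->
  avg (fun U => H [seq state s U | s <- ts] (state (t + N) U)) =
  avg (fun U => avg (H [seq state s U | s <- ts])).
Proof.
move=> tk /allP tst; rewrite -(avg_put (selectP (copy (t + N)))).
apply: eq_avg => U; apply: eq_avg => F.
rewrite /state; have [-> _ _] := selectP (copy (t + N)).
congr (H _ _); apply/eq_in_map => s /tst st.
apply/ffunP => i; apply/ffunP => r; rewrite !ffunE.
have c1 := copy_le (i, r) tk; have c2 := copy_mono (i, r) st.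
move: c1; rewrite copyD => c1.
by rewrite inord_eq// ?(leq_trans c2 (ltnW c1))// ltn_eqF.
Qed.

End Path.

(** * Low-degree polynomials of formulas and good seeds *)

Section LowDegree.
Variables (R : realType) (k n m : nat).
Hypothesis n_gt0 : (0 < n)%N.
Let pos := ('I_m * 'I_k)%type.
Let slot_pos (a : 'I_#|slot k n m|) : pos := (enum_val a).1.

Lemma encode_fput (p : pos) (F : formula k n m) l a : slot_pos a != p ->
  encode R (fput p F l) 0 a = encode R F 0 a.
Proof.
rewrite /slot_pos !mxE; case: (enum_val a) => [[i j] s] /= np.
by rewrite !ffunE (negbTE np).
Qed.

(** The polynomial is split into monomials. One of degree at most [D] contains at most [D]
    indicators, hence depends on at most [D] positions of the formula, which is what
    [sum_influence_le] counts. *)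
Lemma low_degree_influence (D : nat) (f : 'rV[R]_#|slot k n m| -> 'rV[R]_n) (i : 'I_n) :
  degree_poly D f ->
  \sum_p influence (@fput n k m) p (fun F => f (encode R F) 0 i) <=
  D%:R * dot (fun F => f (encode R F) 0 i) (fun F => f (encode R F) 0 i).
Proof.
move=> /(_ i)[p sp fp]; rewrite -big_enum.
apply: (@sum_influence_le R (formula k n m) (literal n) pos _ (@fput n k m)
  (@fputP n k m) (@fputC n k m) _ _ D (mpoly.msupp p)
  (fun mu F => mpoly.mcoeff mu p * \prod_a encode R F 0 a ^+ mu a)
  (fun mu q => [exists a, (mu a != 0%N) && (slot_pos a == q)])).
- exact: enum_uniq.
- move=> mu q _ /existsPn nJ F l; congr (_ * _); apply: eq_bigr => a _.
  have [->|ma] := eqVneq (mu a) 0%N; first by rewrite !expr0.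
  by have := nJ a; rewrite ma /= => /encode_fput ->.
- move=> mu msp.
  have dmu : (mpoly.mdeg mu <= D)%N.
    by rewrite -ltnS; apply: leq_trans sp; exact: mpoly.msize_mdeg_lt.
  rewrite -sum1_count big_enum_cond /= sum1_card; apply: leq_trans dmu.
  apply: (@leq_trans #|[pred a | mu a != 0%N]|).
    apply: leq_trans (leq_imset_card slot_pos _); apply: subset_leq_card.
    apply/fintype.subsetP => q; rewrite unfold_in => /existsP[a /andP[ma /eqP <-]].
    exact: imset_f.
  rewrite mpoly.mdegE -sum1_card big_mkcond /=; apply: leq_sum => a _.
  by rewrite inE; case: (mu a).
- by apply/funext => F; rewrite fp mpoly.mevalE.
Qed.
End LowDegree.

(** * Choice of a good seed *)

Section Measure.
Variables (R : realType) (d : measure_display) (T : measurableType d).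
Variables (P : probability T R) (F : finType).
Hypothesis F_gt0 : (0 < #|F|)%N.
Local Open Scope ereal_scope.

Lemma exists_typical (G : F -> set T) (h : F -> T -> R) (dlt M : R) :
  (forall x, measurable (G x)) -> (forall x, measurable_fun setT (h x)) ->
  (forall x w, (0 <= h x w)%R) -> (0 < dlt)%R -> (0 < M)%R ->
  (1 - dlt)%:E <= (#|F|%:R^-1)%:E * \sum_(x : F) P (G x) ->
  (#|F|%:R^-1)%:E * \sum_(x : F) \int[P]_w (h x w)%:E <= M%:E ->
  exists w, (avg (fun x => (~~ `[< G x w >])%:R) <= 3 * dlt)%R /\
            (avg (h^~ w) <= 3 * M)%R.
Proof.
move=> mG mh h0 d0 M0 hG hM.
have F0 : (0 < #|F|%:R :> R)%R by rewrite ltr0n.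
pose pG x := fine (P (G x)).
have pGE x : P (G x) = (pG x)%:E by rewrite /pG fineK// fin_num_measure.
pose c := (#|F|%:R^-1 : R)%R; have c0 : (0 < c)%R by rewrite invr_gt0.
pose a := (c / (3 * dlt))%R; pose b := (c / (3 * M))%R.
have a0 : (0 < a)%R by rewrite divr_gt0// mulr_gt0.
have b0 : (0 < b)%R by rewrite divr_gt0// mulr_gt0.
(* Markov's inequality for both requirements at once: the two quantities are divided by their
   targets and added. The mean is at most 2/3, while a seed violating either requirement makes the
   sum at least 1. *)
pose X x w : \bar R := a%:E * (\1_(~` G x) w)%:E + b%:E * (h x w)%:E.
apply: contrapT => /forallNP no.
have X1 w : 1 <= \sum_x X x w.
  have -> : \sum_x X x w = ((avg (fun x => (~~ `[< G x w >])%:R)) / (3 * dlt) +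
      avg (h^~ w) / (3 * M))%:E.
    rewrite /X (eq_bigr (fun x => (a * (~~ `[< G x w >])%:R + b * h x w)%:E)); last first.
      move=> x _; rewrite EFinD !EFinM; congr (_ * _%:E + _); rewrite indicE.
      congr (nat_of_bool _)%:R; apply/idP/idP => [/set_mem nG|/asboolPn nG].
        exact/asboolPn.
      exact/mem_set.
    rewrite sumEFin big_split /= -!mulr_sumr /avg; congr (_ + _)%:E.
      by rewrite /a -/c mulrAC.
    by rewrite /b -/c mulrAC.
  rewrite lee_fin leNgt; apply/negP => lt1; apply: (no w).
  have A0 : (0 <= avg (fun x => (~~ `[< G x w >])%:R) / (3 * dlt) :> R)%R.
    by rewrite divr_ge0 ?avg_ge0// mulr_ge0// ltW.
  have B0 : (0 <= avg (h^~ w) / (3 * M))%R.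
    by rewrite divr_ge0 ?avg_ge0// mulr_ge0// ltW.
  split; rewrite -[leRHS]mul1r -ler_pdivrMr ?mulr_gt0//; lra.
have mI x : measurable_fun setT (fun w => (\1_(~` G x) w)%:E).
  by apply/measurable_EFinP; apply: measurable_indic; exact: measurableC.
have mX1 x : measurable_fun setT (fun w => a%:E * (\1_(~` G x) w)%:E).
  exact: measurable_funeM.
have mhE x : measurable_fun setT (fun w => (h x w)%:E) by exact/measurable_EFinP.
have mX2 x : measurable_fun setT (fun w => b%:E * (h x w)%:E).
  exact: measurable_funeM.
have X10 x w : 0 <= a%:E * (\1_(~` G x) w)%:E.
  by apply: mule_ge0; rewrite lee_fin; [exact: ltW|rewrite indicE].
have X20 x w : 0 <= b%:E * (h x w)%:E.
  by apply: mule_ge0; rewrite lee_fin//; exact: ltW.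
have : \int[P]_w cst 1 w <= \int[P]_w \sum_x X x w.
  apply: ge0_le_integral => //.
  by apply: emeasurable_sum => x; exact: emeasurable_funD.
rewrite integral_cst// [X in X <= _ -> _](_ : _ = 1); last first.
  by rewrite mul1e; exact: probability_setT.
rewrite ge0_integral_sum//; last 2 first.
- by move=> x; exact: emeasurable_funD.
- by move=> x w _; rewrite adde_ge0.
have IX x : \int[P]_w X x w = (a * (1 - pG x))%:E + b%:E * \int[P]_w (h x w)%:E.
  rewrite ge0_integralD//; congr (_ + _); last first.
    by apply: ge0_integralZl_EFin => //; first [exact: ltW|move=> w _; rewrite lee_fin ?indicE].
  have -> : \int[P]_w (a%:E * (\1_(~` G x) w)%:E) = a%:E * \int[P]_w (\1_(~` G x) w)%:E.
    by apply: ge0_integralZl_EFin => //; first [exact: ltW|move=> w _; rewrite lee_fin ?indicE].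
  rewrite integral_indic ?setIT//; last exact: measurableC.
  rewrite [in RHS]EFinM; congr (_ * _); rewrite EFinB -pGE; exact: probability_setC.
rewrite (eq_bigr _ (fun x _ => IX x)) big_split /= sumEFin -mulr_sumr.
have bS : \sum_x b%:E * \int[P]_w (h x w)%:E = b%:E * \sum_x \int[P]_w (h x w)%:E.
  by rewrite ge0_sume_distrr// => x _; apply: integral_ge0 => w _; rewrite lee_fin.
rewrite bS.
have : b%:E * \sum_x \int[P]_w (h x w)%:E <= (3^-1 : R)%:E.
  have -> : b%:E = ((3 * M)^-1)%:E * c%:E by rewrite -EFinM mulrC.
  rewrite -muleA; apply: (@le_trans _ _ (((3 * M)^-1)%:E * M%:E)).
    by apply: lee_wpmul2l => //; rewrite lee_fin invr_ge0 mulr_ge0// ltW.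
  by rewrite -EFinM lee_fin invfM mulrC mulrA mulrAC divff ?mul1r// gt_eqF.
have : (a * \sum_x (1 - pG x) <= 3^-1)%R.
  move: hG; rewrite (eq_bigr _ (fun x _ => pGE x)) sumEFin -EFinM lee_fin => hG.
  have -> : (\sum_x (1 - pG x) = #|F|%:R - \sum_x pG x)%R.
    by rewrite sumrB sumr_const.
  rewrite /a mulrAC ler_pdivrMr ?mulr_gt0// mulrA mulVf// mul1r mulrBr mulVf ?gt_eqF//.
  by rewrite /c; lra.
move=> h1 h2 h3.
have : 1 <= (3^-1 + 3^-1 : R)%:E.
  by apply: (le_trans h3); rewrite EFinD leeD// lee_fin.
by rewrite lee_fin; lra.
Qed.

End Measure.

Section Typical.
Variables (R : realType) (d : measure_display) (T : measurableType d).

Lemma measurable_round1 (x : option bool) : measurable [set r : R | round1 r = x].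
Proof.
have mT : measurable [set r : R | round1 r = Some true].
  rewrite (_ : [set _ | _] = `[1, +oo[%classic); first exact: measurable_itv.
  apply/seteqP; split => r /=; rewrite in_itv/= andbT /round1.
    by case: ifP => // _; case: ifP.
  by move=> ->.
have mF : measurable [set r : R | round1 r = Some false].
  rewrite (_ : [set _ | _] = `]-oo, -1]%classic); first exact: measurable_itv.
  apply/seteqP; split => r /=; rewrite in_itv/= /round1.
    by case: ifP => // _; case: ifP.
  by move=> r1; rewrite r1; case: ifP => // r2; exfalso; lra.
case: x => [[]//|].
rewrite (_ : [set _ | _] =
  ~` ([set r : R | round1 r = Some true] `|` [set r : R | round1 r = Some false])).
  by apply: measurableC; exact: measurableU.
apply/seteqP; split => r /=; first by move=> -> [].
by case: (round1 r) => [[]|//] => /not_orP[].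
Qed.

Variables (k n m D : nat) (f : 'rV[R]_#|slot k n m| -> T -> 'rV[R]_n).
Hypothesis fD : random_degree_poly D f.

Lemma measurable_round (x : 'rV[R]_#|slot k n m|) (Q : set (err_assignment n)) :
  measurable [set w | Q (round (f x w))].
Proof.
rewrite (_ : [set _ | _] = \bigcup_(z in Q)
  \bigcap_(i in [set: 'I_n]) [set w | round1 (f x w 0 i) = z i]); last first.
  apply/seteqP; split => w /=.
    by move=> Qw; exists (round (f x w)) => // i _ /=; rewrite ffunE.
  move=> [z Qz zw]; suff -> : round (f x w) = z by [].
  by apply/ffunP => i; rewrite ffunE; exact: zw.
apply: fin_bigcup_measurable => [|z _]; first exact: finite_finset.
apply: fin_bigcap_measurable => [|i _]; first exact: finite_finset.
have := fD.2 x i measurableT _ (measurable_round1 (z i)).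
by rewrite setTI.
Qed.

(** As [delta] may be zero or negative, the argument runs with a positive upper bound [dlt]. *)
Lemma typical_solution (P : probability T R) (delta dlt gamma eta nu : R) :
  (0 < n)%N -> 0 < dlt -> delta <= dlt -> 0 < gamma ->
  solves P delta gamma eta nu f ->
  exists g : 'rV[R]_#|slot k n m| -> 'rV[R]_n,
  [/\ degree_poly D g,
    avg (fun Phi : formula k n m =>
      (~~ `[< eta_nu_satisfies eta nu (round (g (encode R Phi))) Phi >])%:R) <= 3 * dlt &
    avg (fun Phi : formula k n m => sqnorm2 (g (encode R Phi))) <= 3 * (gamma * n%:R)].
Proof.
move=> n0 d0 dd g0 [h1 h2].
have F0 : (0 < #|formula k n m|)%N.
  do 2![rewrite card_ffun expn_gt0; apply/orP; left].
  by rewrite card_prod card_ord card_bool muln_gt0 n0.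
have [|||||||w [w1 w2]] := @exists_typical R d T P (formula k n m) F0
  (fun Phi => [set w | eta_nu_satisfies eta nu (round (f (encode R Phi) w)) Phi])
  (fun Phi w => sqnorm2 (f (encode R Phi) w)) dlt (gamma * n%:R).
- by move=> Phi; exact: (measurable_round (encode R Phi) (fun z => eta_nu_satisfies eta nu z Phi)).
- move=> Phi; apply: measurable_sum => i; apply: measurable_funX.
  exact: fD.2.
- by move=> Phi w; apply: sumr_ge0 => i _; rewrite sqr_ge0.
- by [].
- by rewrite mulr_gt0// ltr0n.
- by apply: le_trans h1; rewrite lee_fin; lra.
- exact: h2.
by exists (f^~ w); split => //; exact: fD.1.
Qed.

End Typical.

(** * Forbidden structures *)

Section Events.
Variables (R : realType) (n k m : nat).
Hypothesis n_gt0 : (0 < n)%N.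
Variable p0 : 'I_m * 'I_k.

Lemma nu_satisfies_unsat (nu : R) y (Phi : formula k n m) : nu_satisfies nu y Phi ->
  #|[pred i | ~~ sat_clause y (Phi i)]|%:R <= nu * m%:R.
Proof.
rewrite /nu_satisfies => h.
have := cardC [pred i : 'I_m | sat_clause y (Phi i)]; rewrite card_ord => e.
have {e} : #|[pred i | sat_clause y (Phi i)]|%:R +
    #|[pred i | ~~ sat_clause y (Phi i)]|%:R = m%:R :> R.
  rewrite -natrD; congr (_%:R); rewrite -[RHS]e; congr (_ + _)%N.
by lra.
Qed.

Lemma avg_nu_satisfies (y : assignment n) (nu theta : R) : 0 <= theta ->
  avg (fun Phi : formula k n m => `[< nu_satisfies nu y Phi >]%:R) <=
  expR (theta * (nu * m%:R) - m%:R * ((1 - expR (- theta)) * 2^-1 ^+ k)).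
Proof.
move=> th0.
apply: le_trans (@chernoff_lower R _ m (fun _ c => ~~ sat_clause y c)
  (2^-1 ^+ k) (nu * m%:R) theta th0 _).
  apply: ler_avg => Phi; case: asboolP => [/nu_satisfies_unsat ->//|_].
  exact: ler0n.
move=> i.
have -> : avg (fun c : {ffun 'I_k -> literal n} => (~~ sat_clause y c)%:R) =
    avg (fun c : {ffun 'I_k -> literal n} =>
      \prod_r (fun l : literal n => (y l.1 != l.2)%:R * 1) (c r)) :> R.
  apply: eq_avg => c; rewrite /sat_clause negb_exists natr_forall.
  by apply: eq_bigr => r _; rewrite mulr1.
rewrite (avg_ffun_prod (fun (_ : 'I_k) (l : literal n) => (y l.1 != l.2)%:R * 1)).
rewrite (eq_bigr (fun=> 2^-1)); first by rewrite prodr_const card_ord.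
by move=> r _; rewrite (avg_literal y (fun=> 1)) avg_const ?mulr1// card_ord.
Qed.

(** Turns a time into a choice of copies at clause position [i]; falsifying clause [i] of the state
    at that time becomes an event on [U i] alone. *)
Definition entry_at (i : 'I_m) (e : assignment n * nat) : entry n k k.+1 :=
  (e.1, fun r => inord (copy e.2 (i, r))).

Lemma falsifies_state (U : sample n k m) i e :
  falsifies (entry_at i e) (U i) = ~~ sat_clause e.1 (state e.2 U i).
Proof.
rewrite /falsifies /sat_clause negb_exists; apply: eq_forallb => r.
by rewrite !ffunE.
Qed.

Lemma card_some_falsified (nu : R) (w : seq (assignment n * nat)) (U : sample n k m) :
  {in w, forall e, nu_satisfies nu e.1 (state e.2 U)} ->
  #|[pred i | some_falsified [seq entry_at i e | e <- w] (U i)]|%:R <=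
  (size w)%:R * (nu * m%:R).
Proof.
elim: w => [|e w IH] h /=.
  by rewrite mul0r [X in X%:R](_ : _ = 0%N)//; apply: eq_card0.
rewrite -nat1r mulrDl mul1r.
apply: (@le_trans _ _ (#|[pred i | ~~ sat_clause e.1 (state e.2 U i)]|%:R +
  #|[pred i | some_falsified [seq entry_at i e | e <- w] (U i)]|%:R)); last first.
  apply: lerD; first by apply: nu_satisfies_unsat; apply: h; rewrite mem_head.
  by apply: IH => e' e'w; apply: h; rewrite inE e'w orbT.
rewrite -natrD ler_nat -cardUI; apply: leq_trans (leq_addr _ _).
apply: subset_leq_card; apply/fintype.subsetP => i; rewrite !inE.
by rewrite /some_falsified /= falsifies_state.
Qed.

(** For a fixed list, the columns [U i] are independent and each is falsified by some entry with
    probability at least [k * 2^-1 ^+ k * xi], whereas joint satisfaction allows at most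
    [(k + 1) * nu * m] falsified columns. *)
Lemma avg_ogp (w : seq (assignment n * nat)) (nu lo hi mu tau xi theta : R) :
  0 <= mu -> 0 < tau -> 0 <= theta -> size w = k.+1 -> entropies_in lo hi (unzip1 w) ->
  xi + expR (mu - (1 - expR (- mu)) * k%:R * ((lo - 2 * expR (- tau)) / tau)) +
    k%:R * expR (- tau) <= 1 ->
  avg (fun U : sample n k m =>
    (all (fun e => `[< nu_satisfies nu e.1 (state e.2 U) >]) w)%:R) <=
  expR (theta * (k.+1%:R * (nu * m%:R)) -
    m%:R * ((1 - expR (- theta)) * (k%:R * (2^-1 ^+ k * xi)))).
Proof.
move=> mu0 tau0 th0 sw ent hxi.
apply: le_trans (@chernoff_lower R _ m
  (fun i W => some_falsified [seq entry_at i e | e <- w] W)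
  (k%:R * (2^-1 ^+ k * xi)) (k.+1%:R * (nu * m%:R)) theta th0 _).
  apply: ler_avg => U; case: allP => [h|_]; last exact: ler0n.
  have -> : k.+1%:R = (size w)%:R :> R by rewrite sw.
  have hw : {in w, forall e, nu_satisfies nu e.1 (state e.2 U)}.
    by move=> e ew; exact/asboolP/h.
  by rewrite (card_some_falsified hw).
move=> i; have := @avg_some_falsified R n k k.+1 n_gt0 [seq entry_at i e | e <- w]
  lo hi mu tau xi k mu0 tau0.
rewrite size_map sw; apply=> //.
by rewrite /unzip1 -map_comp.
Qed.

Lemma sum_tuple_cons (A : finType) L (G : seq A -> R) :
  \sum_(w : L.+1.-tuple A) G w = \sum_(w : L.-tuple A) \sum_(x : A) G (x :: w).
Proof.
rewrite exchange_big pair_bigA /=.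
rewrite (reindex (fun xw : A * L.-tuple A => [tuple of xw.1 :: xw.2]))//.
exists (fun w : L.+1.-tuple A => (thead w, [tuple of behead w])) => [[x w] _|w _] /=.
  by congr (_, _); apply: val_inj.
by rewrite -tuple_eta.
Qed.

(** The bound of [count_centropy] when conditioning on at most [k] assignments, which have at most
    [2 ^ k] patterns on a variable. *)
Definition count_bound (hi : R) : R := n.+1%:R ^+ (2 ^ k) * expR (n%:R * hi).

Lemma count_past (zs : seq (assignment n)) (hi : R) : (size zs <= k)%N ->
  \sum_(z : assignment n) ((centropy R (past zs) z <= hi)%R)%:R <= count_bound hi.
Proof.
move=> sz; pose pat v : (size zs).-tuple bool :=
  map_tuple (fun z : assignment n => z v) (in_tuple zs).
rewrite (eq_bigr (fun z : assignment n => ((centropy R pat z <= hi)%R)%:R)); last first.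
  move=> z _; congr (nat_of_bool (_ <= _))%:R; exact: eq_centropy.
apply: le_trans (count_centropy pat hi) _.
rewrite card_ord card_tuple card_bool ler_wpM2r ?expR_ge0//.
by rewrite ler_weXn2l ?ler1n// leq_exp2l.
Qed.

Lemma count_entropies (T L : nat) (lo hi : R) : (L <= k)%N ->
  \sum_(w : L.+1.-tuple (assignment n * 'I_T.+1))
    (entropies_in lo hi [seq e.1 | e <- w])%:R <=
  2 ^+ n * T.+1%:R * (T.+1%:R * count_bound hi) ^+ L.
Proof.
pose G (w : seq (assignment n * 'I_T.+1)) : R := (entropies_in lo hi [seq e.1 | e <- w])%:R.
rewrite -[leLHS]/(\sum_(w : L.+1.-tuple (assignment n * 'I_T.+1)) G w).
elim: L => [_|L IH Lk].
  rewrite expr0 mulr1 (eq_bigr (fun=> 1)).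
    rewrite sumr_const card_tuple card_prod card_ord card_ffun card_bool card_ord.
    by rewrite expn1 natrM natrX.
  by move=> w _; rewrite /G; case: w => -[|x []].
rewrite (sum_tuple_cons _ G) exprSr mulrA.
apply: le_trans (ler_wpM2r _ (IH (ltnW Lk))); last first.
  by rewrite !mulr_ge0 ?exprn_ge0 ?expR_ge0.
rewrite mulr_suml; apply: ler_sum => w _.
rewrite (eq_bigr (fun x : assignment n * 'I_T.+1 =>
  (((lo <= centropy R (past [seq e.1 | e <- w]) x.1 <= hi)%R)%:R * G w))); last first.
  move=> x _; rewrite /G /= mulrC -natrM mulnb andbC.
  have -> : ([seq e.1 | e <- w] == [::]) = false by case: w => -[].
  by [].
rewrite -mulr_suml mulrC ler_wpM2l// -(pair_bigA _ (fun (x : assignment n) (_ : 'I_T.+1) =>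
  ((lo <= centropy R (past [seq e.1 | e <- w]) x <= hi)%R)%:R)) /=.
rewrite (eq_bigr (fun x : assignment n => T.+1%:R *
  ((lo <= centropy R (past [seq e.1 | e <- w]) x <= hi)%R)%:R)); last first.
  by move=> x _; rewrite sumr_const card_ord -[LHS]mulr_natl.
rewrite -mulr_sumr ler_wpM2l//.
apply: le_trans (@count_past [seq e.1 | e <- w] hi _); last by rewrite size_map size_tuple.
by apply: ler_sum => x _; rewrite ler_nat; case: (lo <= _).
Qed.

Lemma avg_exists_le (A B : finType) (Q : B -> A -> bool) :
  avg (fun u : A => [exists b, Q b u]%:R) <= \sum_b avg (fun u => (Q b u)%:R) :> R.
Proof.
rewrite -avg_sum; apply: ler_avg => u; case: existsP => [[b Qb]|_].
  by rewrite (bigD1 b)//= Qb lerDl sumr_ge0.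
exact: sumr_ge0.
Qed.

Lemma avg_has_le (A B : finType) (Q : B -> A -> bool) (a : pred B) (c : R) :
  (forall b, a b -> avg (fun u => (Q b u)%:R) <= c) ->
  avg (fun u : A => [exists b, a b && Q b u]%:R) <= (\sum_b (a b)%:R) * c.
Proof.
move=> h; apply: (le_trans (avg_exists_le _)); rewrite mulr_suml.
apply: ler_sum => b _; case: (boolP (a b)) => [ab|_] /=; first by rewrite mul1r h.
by rewrite mul0r /avg big1 ?mulr0.
Qed.

Lemma prob_ogp (T : nat) (nu lo hi mu tau xi theta : R) :
  0 <= mu -> 0 < tau -> 0 <= theta ->
  xi + expR (mu - (1 - expR (- mu)) * k%:R * ((lo - 2 * expR (- tau)) / tau)) +
    k%:R * expR (- tau) <= 1 ->
  avg (fun U : sample n k m => [exists w : k.+1.-tuple (assignment n * 'I_T.+1),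
    entropies_in lo hi [seq e.1 | e <- w] &&
    all (fun e : assignment n * 'I_T.+1 => `[< nu_satisfies nu e.1 (state e.2 U) >]) w]%:R) <=
  2 ^+ n * T.+1%:R * (T.+1%:R * count_bound hi) ^+ k *
  expR (theta * (k.+1%:R * (nu * m%:R)) -
    m%:R * ((1 - expR (- theta)) * (k%:R * (2^-1 ^+ k * xi)))).
Proof.
move=> mu0 tau0 th0 hxi.
apply: le_trans (avg_has_le (c := expR (theta * (k.+1%:R * (nu * m%:R)) -
    m%:R * ((1 - expR (- theta)) * (k%:R * (2^-1 ^+ k * xi))))) _) _; last first.
  by rewrite ler_wpM2r ?expR_ge0// count_entropies.
move=> w ent.
have := @avg_ogp [seq (e.1, e.2 : nat) | e : assignment n * 'I_T.+1 <- w]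
  nu lo hi mu tau xi theta mu0 tau0 th0.
rewrite size_map size_tuple /unzip1 -map_comp => /(_ erefl ent hxi).
by apply: le_trans; apply: ler_avg => U; rewrite all_map.
Qed.

(** For fixed times, [avg_fresh] makes the formula one round after the latest one independent of the
    earlier solutions. A union bound over the few assignments of small entropy given these solutions
    concludes. *)
Lemma prob_chaos (T : nat) (nu hi theta : R) (Y : formula k n m -> assignment n) :
  0 <= theta ->
  avg (fun U : sample n k m => [exists L : 'I_k, [exists ts : L.+1.-tuple 'I_T.+1,
    let t := thead ts in
    [&& t + #|{: 'I_m * 'I_k}| <= k * #|{: 'I_m * 'I_k}|,
        all (fun s : 'I_T.+1 => s <= t) ts &
    [exists y : assignment n,
      (centropy R (past [seq Y (state (s : nat) U) | s : 'I_T.+1 <- ts]) y <= hi)%R &&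
      `[< nu_satisfies nu y (state (t + #|{: 'I_m * 'I_k}|) U) >]]]]%N]%:R) <=
  k%:R * (T.+1%:R ^+ k * (count_bound hi *
    expR (theta * (nu * m%:R) - m%:R * ((1 - expR (- theta)) * 2^-1 ^+ k)))).
Proof.
move=> th0; set E := expR _.
apply: (le_trans (avg_exists_le _)).
rewrite [leRHS](_ : _ = \sum_(L < k) (T.+1%:R ^+ k * (count_bound hi * E))); last first.
  by rewrite sumr_const card_ord -[RHS]mulr_natl.
apply: ler_sum => L _; apply: (le_trans (avg_exists_le _)).
have c0 : 0 <= count_bound hi * E by rewrite !mulr_ge0 ?exprn_ge0 ?expR_ge0.
apply: (@le_trans _ _ (\sum_(ts : L.+1.-tuple 'I_T.+1) (count_bound hi * E))); last first.
  rewrite sumr_const card_tuple card_ord -[leLHS]mulr_natl natrX ler_wpM2r//.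
  by rewrite ler_weXn2l// ler1n.
apply: ler_sum => ts _ /=.
set t := thead ts; set N := #|_|.
have [tN|_] := boolP (t + N <= k * N)%N; last by rewrite /avg big1 ?mulr0.
have [tst|_] := boolP (all _ ts); last by rewrite /avg big1 ?mulr0.
rewrite /=.
pose H (zs : seq (formula k n m)) (Phi : formula k n m) : R :=
  [exists y : assignment n, (centropy R (past [seq Y z | z <- zs]) y <= hi)%R &&
     `[< nu_satisfies nu y Phi >]]%:R.
have := @avg_fresh R n k m p0 t [seq (s : nat) | s : 'I_T.+1 <- ts] H tN.
rewrite all_map => /(_ tst) {}tst.
rewrite (eq_avg (_ : _ =1 fun U => H [seq state s U | s <- [seq (s : nat) | s : 'I_T.+1 <- ts]]
  (state (t + N) U))); last by move=> U; rewrite /H /= -!map_comp.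
rewrite tst; apply: avg_le_const => // U.
rewrite /H; set zs := [seq Y z | z <- _].
apply: le_trans (avg_has_le (a := fun y : assignment n => (centropy R (past zs) y <= hi)%R)
  (Q := fun y Phi => `[< nu_satisfies nu y Phi >]) (c := E) _) _; last first.
  rewrite ler_wpM2r ?expR_ge0//; apply: count_past.
  by rewrite !size_map size_tuple ltn_ord.
move=> y _; exact: avg_nu_satisfies.
Qed.

End Events.

(** * Stability along the path *)

Section Deterministic.
Variables (R : realType) (n k m : nat).
Hypothesis n_gt0 : (0 < n)%N.
Variable p0 : 'I_m * 'I_k.
Let N := #|{: 'I_m * 'I_k}|.
Variables (D : nat) (g : 'rV[R]_#|slot k n m| -> 'rV[R]_n).
Hypothesis gD : degree_poly D g.
Variable s0 : R.
Hypothesis s0_gt0 : 0 < s0.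

Let G (Phi : formula k n m) : 'rV[R]_n := g (encode R Phi).

(** The 4 fits [round1_opposite]: values rounded to opposite truth values differ by at least 2, so
    without a jump at most [s0 * n] variables flip that way. *)
Definition jump : rel (formula k n m) :=
  fun Phi Phi' => 4 * s0 * n%:R < sqnorm2 (G Phi - G Phi').

Lemma jump_sym : symmetric jump.
Proof.
move=> Phi Phi'; rewrite /jump; congr (_ < _); apply: eq_bigr => i _.
by rewrite !mxE -sqrrN opprB.
Qed.

Lemma jump_irr : irreflexive jump.
Proof.
move=> Phi; apply/negbTE; rewrite -leNgt /sqnorm2 big1; last first.
  by move=> i _; rewrite subrr mxE expr0n.
by rewrite mulr_ge0// mulr_ge0// ltW.
Qed.

(** Markov's inequality for the squared displacement, whose mean is twice the influence, followed by
    the influence bound in each output coordinate. *)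
Lemma sum_jump_rate :
  \sum_p bad_rate R (@fput n k m) jump p <=
  2 * D%:R * avg (fun Phi => sqnorm2 (G Phi)) / (4 * s0 * n%:R).
Proof.
have c0 : 0 < 4 * s0 * n%:R by rewrite pmulr_lgt0 ?ltr0n// pmulr_rgt0.
apply: (@le_trans _ _ (\sum_p avg (fun Phi => avg (fun l =>
    sqnorm2 (G Phi - G (fput p Phi l)))) / (4 * s0 * n%:R))).
  apply: ler_sum => p _; rewrite -avgZr; apply: ler_avg => Phi.
  rewrite -avgZr; apply: ler_avg => l; rewrite /jump.
  have [h|_] := boolP (_ < sqnorm2 _).
    by rewrite ler_pdivlMr// mul1r ltW.
  by apply: divr_ge0; [apply: sumr_ge0 => i _; rewrite sqr_ge0|exact: ltW].
rewrite -mulr_suml ler_wpM2r ?invr_ge0//; first exact: ltW.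
pose gi i (Phi : formula k n m) := G Phi 0 i.
have -> : \sum_p avg (fun Phi => avg (fun l => sqnorm2 (G Phi - G (fput p Phi l)))) =
    \sum_(i < n) 2 * \sum_p influence (@fput n k m) p (gi i).
  under [RHS]eq_bigr do rewrite mulr_sumr.
  rewrite exchange_big; apply: eq_bigr => p _ /=.
  under [RHS]eq_bigr do rewrite -(influenceE (@fputP n k m)).
  rewrite -avg_sum; apply: eq_avg => Phi; rewrite -avg_sum; apply: eq_avg => l.
  by apply: eq_bigr => i _; rewrite !mxE.
rewrite -mulr_sumr -mulrA ler_wpM2l// /sqnorm2 avg_sum mulr_sumr.
apply: ler_sum => i _; apply: le_trans (low_degree_influence _ gD) _.
rewrite ler_wpM2l//; apply: ler_avg => Phi; by rewrite expr2.
Qed.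

Lemma round1_opposite (a b : R) (y y' : bool) :
  (y != y')%:R <= (round1 a != Some y)%:R + (round1 b != Some y')%:R + (a - b) ^+ 2 / 4.
Proof.
have q0 : 0 <= (a - b) ^+ 2 / 4 by rewrite divr_ge0// sqr_ge0.
have [_|nyy'] := eqVneq y y'; first by rewrite addr_ge0// addr_ge0.
have [ay|_] := eqVneq (round1 a) (Some y); last first.
  by rewrite -addrA lerDl addr_ge0.
have [bY|_] := eqVneq (round1 b) (Some y'); last first.
  by rewrite add0r lerDl.
rewrite !add0r; move: ay bY nyy'; rewrite /round1.
case: ifP => a1; [|case: ifP => a2 //] => -[<-].
  case: ifP => b1; [|case: ifP => b2 //] => -[<-] //= _.
  by rewrite -[leLHS]/(1 : R) ler_pdivlMr// mul1r; nra.
case: ifP => b1; [|case: ifP => b2 //] => -[<-] //= _.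
by rewrite -[leLHS]/(1 : R) ler_pdivlMr// mul1r; nra.
Qed.

Lemma avg_step (eta : R) (Phi Phi' : formula k n m) (y y' : assignment n) :
  ~~ jump Phi Phi' -> Delta R (round (G Phi)) (no_err y) <= eta ->
  Delta R (round (G Phi')) (no_err y') <= eta ->
  avg (fun v => (y v != y' v)%:R) <= 2 * eta + s0.
Proof.
rewrite /jump -leNgt => nj h h'.
have DE (x : 'rV[R]_n) (z : assignment n) :
    Delta R (round x) (no_err z) = avg (fun v => (round1 (x 0 v) != Some (z v))%:R).
  rewrite /Delta avg_card card_ord; congr (_%:R / _).
  by apply: eq_card => v; rewrite !inE !ffunE.
rewrite !DE in h h'.
apply: le_trans (ler_avg (fun v => round1_opposite (G Phi 0 v) (G Phi' 0 v) (y v) (y' v))) _.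
rewrite !avgD avgZr.
have : avg (fun v => (G Phi 0 v - G Phi' 0 v) ^+ 2) / 4 <= s0.
  rewrite ler_pdivrMr// /avg card_ord mulrC ler_pdivrMr ?ltr0n//.
  rewrite [s0 * 4]mulrC; apply: le_trans nj; apply: ler_sum => i _.
  by rewrite !mxE.
by lra.
Qed.

Variables (eta nu lo hi a : R) (Y : formula k n m -> assignment n).
Hypotheses (eta_ge0 : 0 <= eta) (lo_gt0 : 0 < lo) (a_gt0 : 0 < a) (a_le : a <= 2^-1).
Hypothesis lo_hi : lo + ((2 * eta + s0) * - ln a + 2 * a) <= hi.

(** A discrete intermediate value argument: from each chosen time, the conditional entropy starts at
    0, has small increments and would exceed [hi] one round later, so it meets the window from [lo]
    to [hi]. *)
Lemma path_obstruction (U : sample n k m) :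
  good_until jump (k * N) U ->
  (forall t : 'I_(k * N).+1, nu_satisfies nu (Y (state t U)) (state t U) /\
     Delta R (round (G (state t U))) (no_err (Y (state t U))) <= eta) ->
  [exists w : k.+1.-tuple (assignment n * 'I_(k * N).+1),
    entropies_in lo hi [seq e.1 | e <- w] &&
    all (fun e : assignment n * 'I_(k * N).+1 =>
      `[< nu_satisfies nu e.1 (state e.2 U) >]) w] \/
  [exists L : 'I_k, [exists ts : L.+1.-tuple 'I_(k * N).+1,
    let t := thead ts in
    [&& t + N <= k * N, all (fun s : 'I_(k * N).+1 => s <= t) ts &
    [exists y : assignment n,
      (centropy R (past [seq Y (state (s : nat) U) | s : 'I_(k * N).+1 <- ts]) y <= hi)%R &&
      `[< nu_satisfies nu y (state (t + N) U) >]]]]]%N.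
Proof.
move=> /forallP good ok.
apply: contrapT => /not_orP[nw /negP/existsPn nch]; apply: nw.
set T := (k * N)%N in good ok nch *.
have Yok t : (t <= T)%N -> nu_satisfies nu (Y (state t U)) (state t U) /\
     Delta R (round (G (state t U))) (no_err (Y (state t U))) <= eta.
  by rewrite -ltnS => tT; exact: (ok (Ordinal tT)).
(* The head of [ts] is the latest time; its bound [L * N] leaves room for one more round before [T]
   as long as [L < k]. *)
have chain L : (L <= k)%N -> exists ts : L.+1.-tuple 'I_T.+1,
    [/\ (thead ts <= L * N)%N, all (fun s : 'I_T.+1 => (s <= thead ts)%N) ts &
        entropies_in lo hi [seq Y (state (s : nat) U) | s : 'I_T.+1 <- ts]].
  elim: L => [_|L IH Lk].
    by exists [tuple ord0]; split => //=; rewrite andbT.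
  have [ts [tL tst ent]] := IH (ltnW Lk).
  set zs := [seq _ | s <- ts] in ent.
  set t := thead ts in tL tst *.
  pose h (s : nat) := centropy R (past zs) (Y (state s U)).
  have tN : (t + N <= L.+1 * N)%N by rewrite mulSnr leq_add2r.
  have tNT : (t + N <= T)%N by apply: leq_trans tN _; rewrite leq_mul2r Lk orbT.
  (* The excluded second alternative is applied to the path's own solution at time [t + N]. *)
  have hT : hi < h (t + N)%N.
    have /existsPn/(_ ts) /= := nch (Ordinal Lk).
    rewrite -/t tNT tst /= => /existsPn/(_ (Y (state (t + N) U))).
    rewrite (asboolT (Yok _ tNT).1) andbT -ltNge; exact.
  (* The solution at time [t] is the head of [zs], so the conditioning determines it. *)
  have ht : h t = 0.
    apply: centropy0 => u v; rewrite /past /zs (tuple_eta ts) /= -/t => -[] //.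
  have hstep s : (s < T)%N -> h s.+1 <= h s + ((2 * eta + s0) * - ln a + 2 * a).
    move=> sT; apply: centropy_step => //.
    have [_ d1] := Yok _ sT; have [_ d2] := Yok _ (ltnW sT).
    apply: avg_step d1 d2; rewrite jump_sym.
    exact: (good (Ordinal sT)).
  have e0 : 0 <= (2 * eta + s0) * - ln a + 2 * a.
    have la : 0 <= - ln a by rewrite oppr_ge0 ln_le0//; have := a_le; lra.
    have : 0 <= (2 * eta + s0) * - ln a
      by apply: mulr_ge0 => //; have := s0_gt0; have := eta_ge0; lra.
    by have := a_gt0; lra.
  have lohi : lo <= hi by have := lo_hi; lra.
  have ex : exists s, (t <= s)%N && (lo <= h s).
    exists (t + N)%N; rewrite leq_addr /=; exact/ltW/(le_lt_trans lohi hT).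
  (* First time of entropy at least [lo]: one step before, it was still below [lo], so a single
     increment cannot carry it beyond [hi]. *)
  case: (ex_minnP ex) => s /andP[ts1 hs] smin.
  have sle : (s <= t + N)%N.
    apply: smin; rewrite leq_addr /=; exact/ltW/(le_lt_trans lohi hT).
  have st : (t < s)%N.
    rewrite ltn_neqAle ts1 andbT; apply/eqP => tsE.
    by move: hs; rewrite -tsE ht leNgt lo_gt0.
  have hs1 : h s.-1 < lo.
    rewrite ltNge; apply/negP => h1.
    have /smin : (t <= s.-1)%N && (lo <= h s.-1).
      by rewrite h1 andbT -ltnS prednK// (leq_ltn_trans _ st).
    by rewrite -ltnS prednK ?ltnn// (leq_ltn_trans _ st).
  have sT : (s < T.+1)%N by rewrite ltnS (leq_trans sle).
  exists [tuple of Ordinal sT :: ts]; rewrite theadE /=; split.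
  - exact: leq_trans sle tN.
  - rewrite leqnn /=; apply: sub_all tst => r rt.
    exact: leq_trans rt ts1.
  rewrite -/zs ent andbT hs /=; apply/orP; right.
  have sp : s = s.-1.+1 by rewrite prednK// (leq_ltn_trans _ st).
  apply: (le_trans _ lo_hi); rewrite -/(h s) sp.
  apply: (le_trans (hstep s.-1 _)); first by rewrite -sp.
  by lra.
have [ts [_ _ ent]] := chain k (leqnn k).
apply/existsP; exists (map_tuple (fun s : 'I_T.+1 => (Y (state s U), s)) ts).
rewrite -map_comp ent /= all_map; apply/allP => s _ /=.
exact/asboolP/(ok s).1.
Qed.

End Deterministic.

Lemma natr_bool_lt (R : realType) (b1 b2 b3 b4 : bool) :
  b1%:R + b2%:R + b3%:R < b4%:R :> R -> [/\ ~~ b1, ~~ b2, ~~ b3 & b4].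
Proof. by rewrite -!natrD ltr_nat; case: b1 b2 b3 b4 => [] [] [] []. Qed.

(** The left side bounds from below the probability of a path without jumps. If it exceeded the sum
    of the three failure probabilities, some sample would avoid all failures and contradict
    [path_obstruction]. *)
Lemma low_degree_lower_bound (R : realType) (n k m D : nat) (p0 : 'I_m * 'I_k)
    (g : 'rV[R]_#|slot k n m| -> 'rV[R]_n)
    (B dlt s0 eta nu lo hi a mu tau xi theta : R) :
  let T := (k * #|{: 'I_m * 'I_k}|)%N in
  (0 < n)%N -> degree_poly D g ->
  avg (fun Phi : formula k n m =>
    (~~ `[< eta_nu_satisfies eta nu (round (g (encode R Phi))) Phi >])%:R) <= dlt ->
  avg (fun Phi : formula k n m => sqnorm2 (g (encode R Phi))) <= B ->
  0 < s0 -> 0 <= eta -> 0 < lo -> 0 < a -> a <= 2^-1 ->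
  lo + ((2 * eta + s0) * - ln a + 2 * a) <= hi ->
  0 <= mu -> 0 < tau -> 0 <= theta ->
  xi + expR (mu - (1 - expR (- mu)) * k%:R * ((lo - 2 * expR (- tau)) / tau)) +
    k%:R * expR (- tau) <= 1 ->
  expR (- (2 * ln (n%:R * 2) * (k%:R * (2 * D%:R * B / (4 * s0 * n%:R))))) <=
  T.+1%:R * dlt +
  2 ^+ n * T.+1%:R * (T.+1%:R * count_bound n k hi) ^+ k *
    expR (theta * (k.+1%:R * (nu * m%:R)) -
      m%:R * ((1 - expR (- theta)) * (k%:R * (2^-1 ^+ k * xi)))) +
  k%:R * (T.+1%:R ^+ k * (count_bound n k hi *
    expR (theta * (nu * m%:R) - m%:R * ((1 - expR (- theta)) * 2^-1 ^+ k)))).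
Proof.
move=> T n_gt0 gD hfail hB s0p eta0 lo0 a0 a2 hstep mu0 tau0 th0 hxi.
pose sat Phi y := Delta R (round (g (encode R Phi))) (no_err y) <= eta /\
  nu_satisfies nu y Phi.
(* Formulas on which [g] fails get an arbitrary assignment. *)
have /choice[Y HY] : forall Phi : formula k n m, exists y : assignment n,
    eta_nu_satisfies eta nu (round (g (encode R Phi))) Phi -> sat Phi y.
  move=> Phi; have [[y y1 y2]|no] :=
    pselect (eta_nu_satisfies eta nu (round (g (encode R Phi))) Phi).
    by exists y.
  by exists [ffun=> true].
have := @avg_good_ge R n k m n_gt0 p0 (jump g s0) (jump_sym g s0) (jump_irr g s0p).
set E1 := expR _ => good1.
have : expR (- (2 * ln (n%:R * 2) * (k%:R * (2 * D%:R * B / (4 * s0 * n%:R))))) <= E1.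
  rewrite ler_expR lerN2 card_prod card_ord card_bool natrM.
  apply: ler_wpM2l.
    by rewrite mulr_ge0// ln_ge0// -natrM ler1n muln_gt0 n_gt0.
  apply: ler_wpM2l => //; apply: (le_trans (sum_jump_rate n_gt0 gD s0p)).
  apply: ler_wpM2r.
    by rewrite invr_ge0 !mulr_ge0//; exact: ltW.
  by apply: ler_wpM2l => //; rewrite mulr_ge0.
move=> le1; rewrite leNgt; apply/negP => lt1.
have {le1} := lt_le_trans lt1 le1.
move=> /lt_le_trans/(_ good1); rewrite -/T.
set bad2 := 2 ^+ n * _ * _ * _; set bad3 := k%:R * _ => lt2.
have p1 : avg (fun U : sample n k m => [exists t : 'I_T.+1,
    ~~ `[< eta_nu_satisfies eta nu (round (g (encode R (state t U)))) (state t U) >]]%:R)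
    <= T.+1%:R * dlt.
  apply: (le_trans (@avg_exists_le R (sample n k m) 'I_T.+1 (fun t U =>
    ~~ `[< eta_nu_satisfies eta nu (round (g (encode R (state t U)))) (state t U) >]))).
  rewrite [leRHS](_ : _ = \sum_(t < T.+1) dlt); last first.
    by rewrite sumr_const card_ord -[RHS]mulr_natl.
  apply: ler_sum => t _; apply: le_trans hfail.
  by rewrite -(avg_get (selectP n (copy t)) (sample_gt0 k m n_gt0)).
have p2 := @prob_ogp R n k m n_gt0 T nu lo hi mu tau xi theta mu0 tau0 th0 hxi.
have p3 := @prob_chaos R n k m n_gt0 p0 T nu hi theta Y th0.
have := le_lt_trans (lerD (lerD p1 p2) p3) lt2.
rewrite -!avgD => /avg_lt_ex[U] /natr_bool_lt[/existsPn ok nogp nchaos good].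
have [t|h|h] := @path_obstruction R n k m n_gt0 g s0 s0p eta nu lo hi a Y
  eta0 lo0 a0 a2 hstep U good.
- by have := ok t; rewrite negbK => /asboolP/HY[].
- by rewrite h in nogp.
- by rewrite h in nchaos.
Qed.

(** * Parameters *)

Section Numeric.
Variable R : realType.

(** The Taylor term of order [q + 1] of the exponential already dominates. *)
Lemma poly_le_expR (B c : R) (q : nat) : 0 <= B -> 0 < c ->
  exists n0 : nat, forall n, (n0 <= n)%N -> B * n%:R ^+ q <= expR (c * n%:R).
Proof.
move=> B0 c0; pose F : R := (q.+1)`!%:R.
have F0 : 0 < F by rewrite ltr0n fact_gt0.
have cq : 0 < c ^+ q.+1 by rewrite exprn_gt0.
exists (Num.truncn (B * F / c ^+ q.+1)).+1 => n hn.
have hB : B * F <= n%:R * c ^+ q.+1.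
  rewrite -ler_pdivrMr//; apply/ltW.
  apply: lt_le_trans (_ : _ < (Num.truncn (B * F / c ^+ q.+1)).+1%:R) _.
    by apply: truncnS_gt; rewrite num_real.
  by rewrite ler_nat.
apply: le_trans (expR_ge1Dxn q _); last by rewrite mulr_ge0// ltW.
rewrite -[leLHS]add0r lerD// ler_pdivlMr// exprMn [n%:R ^+ q.+1]exprS -/F.
have := ler_wpM2l (exprn_ge0 q (ler0n R n)) hB.
by lra.
Qed.

(* [b] minimizes [iota_ksat]. The conditional entropies in forbidden lists lie
   between [(1 + 2 e) b log k / k] and [(1 + 3 e) b log k / k]; [eps] bounds the
   error terms that vanish as [k] grows, and [s] is the room left in the
   exponent of the first moment. *)
Definition admissible (kappa b e eps s : R) : Prop :=
  let rho := b * expR (- (b - 1)) in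
  [/\ 1 < b, 0 < e <= 1, 0 < eps, 0 < s & [/\ 0 < rho < 1, 1 < kappa &
      b * (1 + 3 * e) + s <= kappa * (1 - rho - 4 * eps)]].

Definition large_for (e eps s : R) (k : nat) : Prop :=
  let L := ln k%:R : R in
  [/\ (0 < k)%N, 2 <= e * L, expR (- (e * L)) <= eps, k%:R^-1 <= eps &
      2 <= L * s /\ 1 <= L].

Lemma threshold_parameters (kappa : R) : kappa_star R < kappa ->
  exists b e eps s : R, admissible kappa b e eps s.
Proof.
move=> hk; have [b b1 [kb _]] := kappa_starP R.
have [d0 [d1 _]] := iota_ksat_den b1.
set rho := b * expR (- (b - 1)) in d0 d1 *.
have bk : b < kappa by apply: le_lt_trans hk; rewrite kb iota_ksat_ge.
have sig : 0 < kappa * (1 - rho) - b.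
  by move: hk; rewrite kb /iota_ksat -/rho ltr_pdivrMr// subr_gt0.
set sigma := kappa * (1 - rho) - b in sig.
have k0 : 0 < kappa by lra.
have b0 : 0 < b by lra.
(* The gap [sigma] is shared out: half goes to [s], at most a quarter to [3 * b * e] and a quarter
   to [4 * kappa * eps]. *)
exists b, (Num.min 1 (sigma / (12 * b))), (sigma / (16 * kappa)), (sigma / 2).
have E0 : 0 < sigma / (12 * b) by rewrite divr_gt0// mulr_gt0.
split => //.
- by rewrite lt_min ltr01 E0 ge_min lexx.
- by rewrite divr_gt0// mulr_gt0.
- by rewrite divr_gt0.
- have r0 : 0 < rho by rewrite mulr_gt0 ?expR_gt0.
  rewrite -/rho; split; [by apply/andP; split; lra|by lra|].
  set e := Num.min _ _.
  have eb : b * (12 * e) <= sigma.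
    have : e <= sigma / (12 * b) by rewrite ge_min lexx orbT.
    by rewrite ler_pdivlMr ?mulr_gt0//; lra.
  have -> : kappa * (1 - rho - 4 * (sigma / (16 * kappa))) = kappa * (1 - rho) - sigma / 4.
    by field; rewrite gt_eqF.
  by rewrite /sigma in eb *; lra.
Qed.

Lemma large_k (e eps s c1 : R) : 0 < e -> 0 < eps -> 0 < s ->
  exists kstar : nat, forall k : nat, (kstar <= k)%N ->
    large_for e eps s k /\ - ln c1 <= ln k%:R.
Proof.
move=> e0 eps0 s0.
(* Each summand serves one of the lower bounds required of [ln k]. *)
pose M := 2 / e + `|ln eps| / e + `|ln eps| + 2 / s + `|ln c1| + 1.
have h1 : 0 < 2 / e by rewrite divr_gt0.
have h2 : 0 <= `|ln eps| / e by rewrite divr_ge0// ltW.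
have h3 : 0 < 2 / s by rewrite divr_gt0.
have h4 : 0 <= `|ln eps| by [].
have h5 : 0 <= `|ln c1| by [].
exists (Num.truncn (expR M)).+1 => k hk; set L := ln k%:R.
have kM : expR M < k%:R.
  apply: lt_le_trans (_ : _ < (Num.truncn (expR M)).+1%:R) _.
    by apply: truncnS_gt; rewrite num_real.
  by rewrite ler_nat.
have k0 : 0 < k%:R :> R by apply: lt_trans kM; exact: expR_gt0.
have ML : M <= L by rewrite -[M]expRK ler_ln ?posrE ?expR_gt0// ltW.
have Le : expR (- L) = k%:R^-1 by rewrite expRN lnK ?posrE.
have leps := ler_norm (- ln eps); rewrite normrN in leps.
split; last by have := ler_norm (- ln c1); rewrite normrN; rewrite /M in ML; lra.
rewrite /large_for -/L; split.
- by rewrite -(ltr0n R).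
- by rewrite mulrC -ler_pdivrMr//; rewrite /M in ML; lra.
- rewrite -[leRHS]lnK ?posrE// ler_expR.
  have : `|ln eps| <= e * L by rewrite mulrC -ler_pdivrMr//; rewrite /M in ML; lra.
  by lra.
- rewrite -Le -[leRHS]lnK ?posrE// ler_expR; rewrite /M in ML; lra.
- split; last by rewrite /M in ML; lra.
  by rewrite -ler_pdivrMr//; rewrite /M in ML; lra.
Qed.

End Numeric.

(** * Exponents of the two first moment bounds for fixed k *)

Section FixedK.
Variables (R : realType) (kappa b e eps s : R) (k : nat).
Let L : R := ln k%:R.
Let rho : R := b * expR (- (b - 1)).
Hypothesis adm : admissible kappa b e eps s.
Hypothesis k_large : large_for e eps s k.

Ltac unpack :=
  have := adm; rewrite /admissible -/rho;
  move=> [b1 /andP[e0 e1] eps0 s_gt0 [/andP[rho0 rho1] kappa1 main_ineq]];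
  have := k_large; rewrite /large_for -/L; move=> [k_gt0 H1 H2 H3 [H4 H6]].

Let lo := (1 + 2 * e) * b * L / k%:R.
Let hi := (1 + 3 * e) * b * L / k%:R.
Let tau := (1 + e) * L.
Let xi := 1 - rho - eps.
Let w : R := 2^-1 ^+ k.
Let nu : R := 1 / (k%:R ^+ 2 * 2 ^+ k).
Let alpha : R := kappa * 2 ^+ k * L / k%:R.

Let k0 : 0 < k%:R :> R. Proof. by unpack; rewrite ltr0n. Qed.
Let L0 : 0 < L. Proof. by unpack; lra. Qed.
Let expRL : expR (- L) = k%:R^-1. Proof. by rewrite expRN lnK ?posrE. Qed.

Lemma k_ge1 : 1 <= k%:R :> R. Proof. by unpack; rewrite ler1n. Qed.

(** The choice [mu = ln b] minimizes [mu - (1 - expR (- mu)) * b], with value [ln b - (b - 1)],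
    whence [rho]. The gap between [1 + 2 * e] in [lo] and [1 + e] in [tau] absorbs the truncation
    error. *)
Lemma entropy_condition :
  xi + expR (ln b - (1 - expR (- ln b)) * k%:R * ((lo - 2 * expR (- tau)) / tau)) +
    k%:R * expR (- tau) <= 1.
Proof.
unpack.
have b0 : 0 < b by lra.
have t0 : 0 < tau by rewrite mulr_gt0//; lra.
have eL : k%:R * expR (- tau) = expR (- (e * L)).
  by rewrite /tau mulrDl mul1r opprD expRD expRL mulrA divff ?mul1r// gt_eqF.
rewrite eL.
suff : expR (ln b - (1 - expR (- ln b)) * k%:R * ((lo - 2 * expR (- tau)) / tau)) <= rho.
  by rewrite /xi; lra.
rewrite expRD lnK ?posrE// /rho ler_pM2l// ler_expR lerN2 expRN lnK ?posrE//.
have : b <= k%:R * ((lo - 2 * expR (- tau)) / tau).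
  rewrite mulrA ler_pdivlMr// mulrBr [k%:R * (2 * _)]mulrCA eL /lo.
  rewrite [k%:R * (_ / _)]mulrC divfK ?gt_eqF//.
  have : expR (- (e * L)) <= 1 by rewrite expR_le1; lra.
  rewrite /tau => h; have : b * (e * L) >= 1 * 2 by apply: ler_pM => //; lra.
  by lra.
move=> h; have -> : b - 1 = (1 - b^-1) * b by rewrite mulrBl mul1r mulVf// gt_eqF.
by rewrite -mulrA ler_wpM2l// subr_ge0 invf_le1// ltW.
Qed.

(** After multiplication by [k], one step costs at most [8 * c1 * L = e * L], and the window has
    width [e * b * L]; this fixes [c1 = e / 8]. *)
Lemma step_condition (c1 : R) : 0 < c1 -> c1 = e / 8 -> - ln c1 <= L ->
  lo + ((2 * (c1 / k%:R) + c1 / k%:R) * - ln (c1 / k%:R) + 2 * (c1 / k%:R)) <= hi.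
Proof.
unpack.
move=> c10 c1E H5; rewrite ln_div ?posrE// -/L.
have -> : hi = lo + e * b * L / k%:R by rewrite /hi /lo; field; rewrite gt_eqF.
rewrite lerD2l ler_pdivlMr//.
have -> : ((2 * (c1 / k%:R) + c1 / k%:R) * - (ln c1 - L) + 2 * (c1 / k%:R)) * k%:R =
   3 * c1 * (L - ln c1) + 2 * c1 by field; rewrite gt_eqF.
have h1 : 3 * c1 * (L - ln c1) <= 3 * c1 * (2 * L) by rewrite ler_pM2l; lra.
have h2 : 2 * c1 * 1 <= 2 * c1 * L by rewrite ler_pM2l; lra.
have h3 : e * L * 1 <= e * L * b by rewrite ler_pM2l ?mulr_gt0//; lra.
have : 8 * c1 * L = e * L by rewrite c1E; field.
by lra.
Qed.

Let w0 : 0 < w. Proof. by rewrite exprn_gt0// invr_gt0. Qed.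
Let w2 : w * 2 ^+ k = 1. Proof. by rewrite /w exprVn mulVf// expf_neq0. Qed.

Lemma nuE : nu = w / k%:R ^+ 2.
Proof. by rewrite /nu /w exprVn invfM mul1r mulrC. Qed.

Lemma wk_le1 : w * k%:R <= 1.
Proof. by rewrite -[leRHS]w2 ler_pM2l// -natrX ler_nat ltnW// ltn_expl. Qed.

Section FixedN.
Variable n : nat.
Hypothesis n_gt0 : (0 < n)%N.
Let m := Num.truncn (alpha * n%:R).
Let n0 : 0 < n%:R :> R. Proof. by rewrite ltr0n. Qed.

Let alpha0 : 0 < alpha.
Proof. by unpack; rewrite divr_gt0// !mulr_gt0 ?exprn_gt0//; lra. Qed.

Lemma mw_ge : kappa * L * n%:R / k%:R - w <= m%:R * w.
Proof.
have := truncn_itv (ltW (mulr_gt0 alpha0 n0)); rewrite -/m -natr1 => /andP[_ /ltW].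
rewrite -(ler_pM2r w0) mulrDl mul1r.
have -> : alpha * n%:R * w = kappa * L * n%:R / k%:R.
  by rewrite -[RHS]mulr1 -[X in _ = _ * X]w2 /alpha; ring.
lra.
Qed.

(* The linear loss from [m >= alpha n - 1] is absorbed in the additive [1]. *)
Lemma rate_bound (r c : R) : 0 < c <= k%:R -> c * (1 - rho - 4 * eps) <= r <= c ->
  - (m%:R * w * r) <= 1 - L * n%:R * (c / k%:R) * (b * (1 + 3 * e) + s).
Proof.
unpack.
move=> /andP[c0 ck] /andP[r1 r2].
have z0 : 0 < 1 - rho - 4 * eps.
  have : 0 < kappa * (1 - rho - 4 * eps).
    apply: lt_le_trans main_ineq; rewrite addr_gt0// mulr_gt0//; lra.
  by rewrite pmulr_rgt0//; lra.
have r0 : 0 <= r by apply: le_trans r1; rewrite mulr_ge0// ltW.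
have h1 := ler_wpM2r r0 mw_ge.
have h2 : w * r <= 1.
  by apply: le_trans wk_le1; rewrite ler_pM2l//; lra.
have p0 : 0 < L * n%:R / k%:R by rewrite !mulr_gt0 ?invr_gt0.
have h3 : L * n%:R / k%:R * c * (b * (1 + 3 * e) + s) <=
          L * n%:R / k%:R * c * (kappa * (1 - rho - 4 * eps)).
  by rewrite ler_pM2l// mulr_gt0.
have h4 : L * n%:R / k%:R * kappa * (c * (1 - rho - 4 * eps)) <=
          L * n%:R / k%:R * kappa * r.
  by rewrite ler_pM2l// mulr_gt0//; lra.
have e1' : kappa * L * n%:R / k%:R * r = L * n%:R / k%:R * kappa * r by ring.
have e2' : L * n%:R * (c / k%:R) = L * n%:R / k%:R * c by ring.
rewrite e2'; lra.
Qed.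

(** Here [theta = L], so [expR (- theta)] is [1 / k]. This loses at most 1 and the term in [nu] at
    most 2, out of about [k * xi]; the room [3 * k * eps] covers both. *)
Lemma ogp_exponent :
  L * (k.+1%:R * (nu * m%:R)) - m%:R * ((1 - expR (- L)) * (k%:R * (w * xi))) <=
  1 - L * n%:R * (b * (1 + 3 * e) + s).
Proof.
unpack.
have [kk1 kL] : 1 <= k%:R :> R /\ L <= k%:R by split; [exact: k_ge1|exact/ltW/ln_sublinear].
have -> : L * (k.+1%:R * (nu * m%:R)) - m%:R * ((1 - expR (- L)) * (k%:R * (w * xi))) =
    - (m%:R * w * ((k%:R - 1) * xi - L * (k%:R + 1) / k%:R ^+ 2)).
  by rewrite nuE expRL -natr1; field; rewrite gt_eqF.
have := @rate_bound ((k%:R - 1) * xi - L * (k%:R + 1) / k%:R ^+ 2) k%:R.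
rewrite divff ?gt_eqF// mulr1; apply; first by rewrite k0 lexx.
have epsk : 1 <= k%:R * eps by move: H3; rewrite -(ler_pM2l k0) divff ?gt_eqF.
have t0 : 0 <= L * (k%:R + 1) / k%:R ^+ 2.
  by rewrite divr_ge0 ?exprn_ge0 ?mulr_ge0 ?addr_ge0 ?ltW.
have t2 : L * (k%:R + 1) / k%:R ^+ 2 <= 2.
  rewrite ler_pdivrMr ?exprn_gt0//; have : L * (k%:R + 1) <= k%:R * (2 * k%:R).
    by apply: ler_pM; lra.
  by lra.
have xi0 : 0 <= xi.
  have : 0 < kappa * (1 - rho - 4 * eps).
    apply: lt_le_trans main_ineq; rewrite addr_gt0// mulr_gt0//; lra.
  by rewrite pmulr_rgt0 /xi; lra.
have xi1 : xi <= 1 by rewrite /xi; lra.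
have : k%:R * xi <= k%:R * 1 by rewrite ler_pM2l.
by move=> hx; apply/andP; split; rewrite /xi in hx xi0 xi1 *; lra.
Qed.

Lemma chaos_exponent :
  L * (nu * m%:R) - m%:R * ((1 - expR (- L)) * w) <=
  1 - L * n%:R / k%:R * (b * (1 + 3 * e) + s).
Proof.
unpack.
have [kk1 kL] : 1 <= k%:R :> R /\ L <= k%:R by split; [exact: k_ge1|exact/ltW/ln_sublinear].
have -> : L * (nu * m%:R) - m%:R * ((1 - expR (- L)) * w) =
    - (m%:R * w * (1 - k%:R^-1 - L / k%:R ^+ 2)).
  by rewrite nuE expRL; field; rewrite gt_eqF.
have := @rate_bound (1 - k%:R^-1 - L / k%:R ^+ 2) 1.
rewrite mul1r div1r; apply; first by rewrite ltr01.
have t0 : 0 <= L / k%:R ^+ 2 by rewrite divr_ge0 ?exprn_ge0 ?ltW.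
have t2 : L / k%:R ^+ 2 <= k%:R^-1.
  by rewrite ler_pdivrMr ?exprn_gt0// expr2 mulKf ?gt_eqF.
have i0 : 0 < k%:R^-1 :> R by rewrite invr_gt0.
by apply/andP; split; lra.
Qed.

(** A common prefactor for both bounds; [expR 1] is the additive 1 of [rate_bound] and [k] the
    number of lengths in [prob_chaos]. *)
Definition poly_factor (A : R) : R :=
  (A * n%:R) ^+ k.+1 * (n%:R * 2) ^+ (2 ^ k * k) * (expR 1 * k%:R).

Section Totals.
Variables T1 A : R.
Hypotheses (A1 : 1 <= A) (T0 : 0 <= T1) (TA : T1 <= A * n%:R).

Let n1 : 1 <= n%:R :> R. Proof. by rewrite ler1n. Qed.
Let An1 : 1 <= A * n%:R. Proof. exact: mulr_ege1. Qed.

Lemma ogp_total :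
  2 ^+ n * T1 * (T1 * count_bound n k hi) ^+ k *
    expR (L * (k.+1%:R * (nu * m%:R)) -
      m%:R * ((1 - expR (- L)) * (k%:R * (2^-1 ^+ k * xi)))) <=
  poly_factor A * expR (- (n%:R / k%:R)).
Proof.
unpack.
have -> : 2 ^+ n * T1 * (T1 * count_bound n k hi) ^+ k =
    T1 ^+ k.+1 * n.+1%:R ^+ (2 ^ k * k) * (2 ^+ n * expR (k%:R * (n%:R * hi))).
  rewrite /count_bound !exprMn -exprM (expRM_natl k) [T1 ^+ k.+1]exprS.
  by move: (_ ^+ (2 ^ k * k)) (expR _ ^+ k) => u v; ring.
set E := expR (L * _ - _); rewrite /poly_factor -[leLHS]mulrA -[leRHS]mulrA.
apply: ler_pM.
- by rewrite mulr_ge0 ?exprn_ge0.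
- by rewrite !mulr_ge0 ?exprn_ge0 ?expR_ge0.
- apply: ler_pM; rewrite ?exprn_ge0//.
    by apply: lerXn2r; rewrite ?nnegrE//; apply: le_trans TA.
  apply: lerXn2r; rewrite ?nnegrE ?mulr_ge0//.
  by rewrite -natr1; move: n1; lra.
rewrite -[leLHS]mulrA.
(* The free choice of the first assignment costs at most [expR n], paid for by [2 <= L * s]. *)
have h2 : 2 ^+ n <= expR n%:R :> R.
  have -> : expR n%:R = expR 1 ^+ n :> R by rewrite -expRM_natl mulr1.
  apply: lerXn2r; rewrite ?nnegrE ?expR_ge0//.
  by have := @expR_ge1Dx R 1; lra.
have hE : E <= expR (1 - L * n%:R * (b * (1 + 3 * e) + s)).
  by rewrite ler_expR; exact: ogp_exponent.
apply: (@le_trans _ _ (expR n%:R * (expR (k%:R * (n%:R * hi)) *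
    expR (1 - L * n%:R * (b * (1 + 3 * e) + s))))).
  apply: ler_pM => //; rewrite ?mulr_ge0 ?exprn_ge0 ?expR_ge0//.
  by apply: ler_wpM2l; rewrite ?expR_ge0.
rewrite -!expRD; apply: (@le_trans _ _ (expR (1 - n%:R / k%:R))).
  rewrite ler_expR.
  have -> : k%:R * (n%:R * hi) = L * n%:R * (b * (1 + 3 * e)).
    by rewrite /hi; field; rewrite gt_eqF.
  have : n%:R * 2 <= n%:R * (L * s) by rewrite ler_pM2l.
  have : n%:R / k%:R <= n%:R :> R by rewrite ler_pdivrMr// ler_peMr ?k_ge1// ltW.
  by lra.
rewrite expRD -mulrA; apply: ler_pM; rewrite ?expR_ge0//.
by rewrite ler_peMl ?expR_ge0// k_ge1.
Qed.

Lemma chaos_total :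
  k%:R * (T1 ^+ k * (count_bound n k hi *
    expR (L * (nu * m%:R) - m%:R * ((1 - expR (- L)) * 2^-1 ^+ k)))) <=
  poly_factor A * expR (- (n%:R / k%:R)).
Proof.
unpack.
set E := expR (L * _ - _).
have hE : E <= expR (1 - L * n%:R / k%:R * (b * (1 + 3 * e) + s)).
  by rewrite ler_expR; exact: chaos_exponent.
have hcE : expR (n%:R * hi) * E <= expR 1 * expR (- (n%:R / k%:R)).
  apply: (@le_trans _ _ (expR (n%:R * hi) *
      expR (1 - L * n%:R / k%:R * (b * (1 + 3 * e) + s)))).
    by rewrite ler_pM2l ?expR_gt0.
  rewrite -!expRD ler_expR.
  have -> : n%:R * hi = L * n%:R / k%:R * (b * (1 + 3 * e)) by rewrite /hi; ring.
  have : n%:R / k%:R * 1 <= n%:R / k%:R * (L * s).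
    by rewrite ler_pM2l ?divr_gt0//; move: H4; lra.
  by lra.
have hT : T1 ^+ k <= (A * n%:R) ^+ k.+1.
  apply: (@le_trans _ _ ((A * n%:R) ^+ k)).
    by apply: lerXn2r; rewrite ?nnegrE//; apply: le_trans TA.
  by rewrite ler_weXn2l.
have hn : n.+1%:R ^+ (2 ^ k) <= (n%:R * 2) ^+ (2 ^ k * k) :> R.
  have n21 : n.+1%:R <= n%:R * 2 :> R by rewrite -natr1; move: n1; lra.
  apply: (@le_trans _ _ ((n%:R * 2) ^+ (2 ^ k))).
    by apply: lerXn2r; rewrite ?nnegrE ?mulr_ge0.
  rewrite ler_weXn2l ?leq_pmulr//.
  by apply: le_trans n21; rewrite ler1n.
rewrite /poly_factor /count_bound.
have -> : k%:R * (T1 ^+ k * (n.+1%:R ^+ (2 ^ k) * expR (n%:R * hi) * E)) =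
    T1 ^+ k * n.+1%:R ^+ (2 ^ k) * (expR (n%:R * hi) * E) * k%:R by ring.
have -> : forall P : R, P * (expR 1 * k%:R) * expR (- (n%:R / k%:R)) =
    P * (expR 1 * expR (- (n%:R / k%:R))) * k%:R by move=> P; ring.
rewrite ler_pM2r//; apply: ler_pM => //.
- by rewrite mulr_ge0 ?exprn_ge0.
- by rewrite mulr_ge0 ?expR_ge0.
- by apply: ler_pM; rewrite ?exprn_ge0.
Qed.

End Totals.
End FixedN.
End FixedK.

(** Each of the three terms is at most [E / 4]. The 2 in [K + 2] yields two factors [1 / n], against
    [T1] and the constants; half of the exponent [n / k] pays for the polynomial [M], the other half
    for [E]. *)
Lemma final_comparison (R : realType) (n k : nat) (A K x M P3 P4 T1 rate : R) :
  let E := expR (- (K * x)) in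
  (0 < n)%N -> 0 < K -> 1 <= A -> 12 * A <= n%:R -> T1 <= A * n%:R -> ln n%:R <= x ->
  4 * M <= expR ((2 * k%:R)^-1 * n%:R) -> K * x <= (2 * k%:R)^-1 * n%:R ->
  P3 <= M * expR (- (n%:R / k%:R)) -> P4 <= M * expR (- (n%:R / k%:R)) ->
  rate <= K * x ->
  T1 * (3 * expR (- ((K + 2) * x))) + P3 + P4 < expR (- rate).
Proof.
move=> E n_gt0 K0 A1 An TA lx hM hKx h3 h4 hr.
have n0 : 0 < n%:R :> R by rewrite ltr0n.
have E0 : 0 < E := expR_gt0 _.
have hE : E <= expR (- rate) by rewrite ler_expR lerN2.
apply: lt_le_trans hE.
have e2x : expR (- ((K + 2) * x)) <= E * (n%:R^-1 * n%:R^-1).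
  have -> : n%:R^-1 = expR (- ln n%:R) :> R by rewrite expRN lnK ?posrE.
  by rewrite /E -!expRD ler_expR; lra.
have p2 : T1 * (3 * expR (- ((K + 2) * x))) <= E / 4.
  apply: (@le_trans _ _ (A * n%:R * (3 * (E * (n%:R^-1 * n%:R^-1))))).
    apply: (@le_trans _ _ (A * n%:R * (3 * expR (- ((K + 2) * x))))).
      by rewrite ler_wpM2r ?mulr_ge0 ?expR_ge0.
    rewrite ler_wpM2l ?mulr_ge0 ?ler_wpM2l//; lra.
  have -> : A * n%:R * (3 * (E * (n%:R^-1 * n%:R^-1))) = E / 4 * (12 * A / n%:R).
    by field; rewrite gt_eqF.
  rewrite ger_pMr; last by rewrite divr_gt0.
  by rewrite ler_pdivrMr// mul1r.
have p34 : M * expR (- (n%:R / k%:R)) <= E / 4.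
  set u := expR ((2 * k%:R)^-1 * n%:R) in hM.
  have u0 : 0 < u := expR_gt0 _.
  have -> : expR (- (n%:R / k%:R)) = u^-1 * u^-1.
    rewrite -expRN -expRD; congr expR; rewrite invfM.
    by lra.
  have uE : u^-1 <= E by rewrite -expRN ler_expR lerN2.
  have hM' : M <= u / 4 by rewrite ler_pdivlMr//; lra.
  apply: (@le_trans _ _ (u / 4 * (u^-1 * u^-1))).
    by rewrite ler_wpM2r// mulr_ge0// invr_ge0 ltW.
  have -> : u / 4 * (u^-1 * u^-1) = u^-1 / 4 by field; rewrite gt_eqF.
  by rewrite ler_wpM2r// invr_ge0.
lra.
Qed.

Unset Implicit Arguments.

Theorem theorem2p6 (R : realType) (kappa : R) (hkappa : kappa_star R < kappa) :
  exists (kstar : nat) (c : R), (0 < kstar)%N /\ 0 < c /\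
  forall k : nat, (kstar <= k)%N ->
  let alpha : R := kappa * 2 ^+ k * ln k%:R / k%:R in
  let nu : R := 1 / (k%:R ^+ 2 * 2 ^+ k) in
  exists (nstar : nat) (eta C1 C2 : R),
    (0 < nstar)%N /\ c / k%:R <= eta /\ 0 < C1 /\ 0 < C2 /\
  forall (n D : nat) (gamma delta : R),
    let m : nat := Num.truncn (alpha * n%:R) in
    (nstar <= n)%N -> 1 <= gamma ->
    (1 <= D)%N -> D%:R <= C1 * n%:R / (gamma * ln n%:R) ->
    delta <= expR (- (C2 * gamma * D%:R * ln n%:R)) ->
    ~ exists (d : measure_display) (T : measurableType d)
        (P : probability T R) (f : 'rV[R]_#|slot k n m| -> T -> 'rV[R]_n),
        random_degree_poly D f /\ solves P delta gamma eta nu f.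
Proof.
have [b [e [eps [s adm]]]] := threshold_parameters hkappa.
have [b1 /andP[e0 e1] eps0 s0 [_ kappa1 _]] := adm.
pose c1 := e / 8; have c10 : 0 < c1 by rewrite divr_gt0.
have [kstar hks] := large_k c1 e0 eps0 s0.
exists kstar.+1, c1; split=> //; split=> // k hk alpha nu.
have [klarge H5] := hks k (ltnW hk); have [k_gt0 _ _ _ [_ H6]] := klarge.
set L := ln k%:R in H5 H6.
have k0 : 0 < k%:R :> R by rewrite ltr0n.
have kk1 : 1 <= k%:R :> R by rewrite ler1n.
have L0 : 0 < L by lra.
have alpha1 : 1 <= alpha.
  rewrite /alpha -/L ler_pdivlMr// mul1r.
  have k2 : k%:R <= 2 ^+ k :> R by rewrite -natrX ler_nat ltnW// ltn_expl.
  apply: (le_trans k2); have p0 : 0 < 2 ^+ k :> R by rewrite exprn_gt0.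
  have : 1 * 2 ^+ k <= kappa * 2 ^+ k by rewrite ler_pM2r//; lra.
  have : kappa * 2 ^+ k * 1 <= kappa * 2 ^+ k * L.
    by rewrite ler_pM2l// mulr_gt0//; lra.
  by lra.
(* Chosen so that the number [k ^ 2 * m + 1] of times on the path is at most [A * n]. *)
pose A : R := k%:R ^+ 2 * alpha + 1.
have A1 : 1 <= A by rewrite lerDr mulr_ge0 ?exprn_ge0//; lra.
pose q := (k.+1 + 2 ^ k * k)%N.
pose B : R := A ^+ k.+1 * 2 ^+ (2 ^ k * k) * (expR 1 * k%:R).
have B0 : 0 <= B by rewrite !mulr_ge0 ?exprn_ge0 ?expR_ge0//; lra.
have ik : 0 < (2 * k%:R)^-1 :> R by rewrite invr_gt0 mulr_gt0.
have [n1 hn1] := poly_le_expR q (mulr_ge0 (ler0n R 4) B0) ik.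
(* With jump size [c1 / k] and second moment [3 * gamma * n], the survival exponent is
   [K / 4 * gamma * D] times [2 * ln (2 * n)], hence at most [K * x] for [n >= 2]. *)
pose K : R := 6 * k%:R ^+ 2 / c1.
have K0 : 0 < K by rewrite divr_gt0// mulr_gt0// exprn_gt0.
exists (maxn (maxn n1 2) (Num.truncn (12 * A)).+1), (c1 / k%:R),
  ((2 * k%:R)^-1 / K), (K + 2).
split; first by rewrite leq_max orbT.
split; first by [].
split; first by rewrite divr_gt0.
split; first by lra.
move=> n D gamma delta m; rewrite !geq_max -andbA => /and3P[nn1 n2 nA] g1 D1 hD hdelta.
move=> [d [T [P [f [fD fsol]]]]].
have n_gt0 : (0 < n)%N by exact: ltnW.
have n0 : 0 < n%:R :> R by rewrite ltr0n.
have An : 12 * A <= n%:R.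
  apply/ltW; apply: lt_le_trans (_ : _ < (Num.truncn (12 * A)).+1%:R) _.
    by apply: truncnS_gt; rewrite num_real.
  by rewrite ler_nat.
have ln2 : 0 < ln 2 :> R by rewrite ln_gt0// ltr1n.
have lnn : ln 2 <= ln n%:R :> R by rewrite ler_ln ?posrE// ler_nat.
have ln0 : 0 < ln n%:R :> R by lra.
pose x := gamma * D%:R * ln n%:R.
have D1' : 1 <= D%:R :> R by rewrite ler1n.
have gD1 : 1 <= gamma * D%:R by exact: mulr_ege1.
have lx : ln n%:R <= x by rewrite /x ler_peMl// ltW.
have x0 : 0 < x by lra.
have hKx : K * x <= (2 * k%:R)^-1 * n%:R.
  move: hD; rewrite ler_pdivlMr; last by rewrite mulr_gt0//; lra.
  have -> : D%:R * (gamma * ln n%:R) = x by rewrite /x; ring.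
  rewrite -(ler_pM2l K0) => /le_trans; apply.
  by rewrite mulrA mulrCA divff ?mulr1// gt_eqF.
have mn : m%:R <= alpha * n%:R by rewrite truncn_le mulr_ge0//; lra.
have m_gt0 : (0 < m)%N.
  rewrite truncn_gt_nat; apply: (@le_trans _ _ (alpha * 1)); first by rewrite mulr1.
  by rewrite ler_pM2l ?ler1n//; lra.
pose p0 : 'I_m * 'I_k := (Ordinal m_gt0, Ordinal k_gt0).
have [||||g [gD g2 g3]] := typical_solution fD _ _ _ _ fsol
  (dlt := expR (- ((K + 2) * x))).
- exact: n_gt0.
- exact: expR_gt0.
- by apply: le_trans hdelta _; rewrite ler_expR lerN2 /x; lra.
- lra.
have s00 : 0 < c1 / k%:R by rewrite divr_gt0.
have blo : 0 < (1 + 2 * e) * b * L / k%:R.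
  by rewrite divr_gt0// !mulr_gt0//; lra.
have c12 : c1 / k%:R <= 2^-1.
  rewrite ler_pdivrMr//; have : 2^-1 * 1 <= 2^-1 * k%:R :> R by rewrite ler_pM2l.
  by rewrite /c1; lra.
have tau0 : 0 < (1 + e) * L by rewrite mulr_gt0//; lra.
(* The single value [c1 / k] serves as jump size [s0], as [eta] and as the guessing error [a] of
   [centropy_step]. *)
have := low_degree_lower_bound p0 n_gt0 gD g2 g3 s00 (ltW s00) blo s00 c12
  (step_condition adm klarge c10 erefl H5)
  (ln_ge0 (ltW b1)) tau0 (ltW L0)
  (entropy_condition adm klarge).
apply/negP; rewrite -ltNge.
set T1 := (_.+1)%:R.
have T1E : T1 = k%:R * (m%:R * k%:R) + 1.
  by rewrite /T1 card_prod !card_ord -natr1 !natrM.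
have T0 : 0 <= T1 by exact: ler0n.
have TA : T1 <= A * n%:R.
  rewrite T1E /A mulrDl mul1r lerD ?ler1n//.
  have -> : k%:R * (m%:R * k%:R) = k%:R ^+ 2 * m%:R :> R by ring.
  by rewrite -mulrA ler_pM2l// exprn_gt0.
apply: (@final_comparison R n k A K x (poly_factor k n A)) => //.
- have -> : poly_factor k n A = B * n%:R ^+ q.
    rewrite /poly_factor /B /q !exprMn exprD.
    move: (2 ^+ (2 ^ k * k)) (n%:R ^+ _) (n%:R ^+ _) (A ^+ _) => u v w z.
    by ring.
  by rewrite mulrA; exact: hn1.
- exact: (ogp_total adm klarge n_gt0 T0 TA).
- exact: (chaos_total adm klarge n_gt0 A1 T0 TA).
have -> : k%:R * (2 * D%:R * (3 * (gamma * n%:R)) / (4 * (c1 / k%:R) * n%:R)) =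
    K / 4 * (gamma * D%:R).
  by rewrite /K; field; rewrite !gt_eqF.
have l2n : ln (n%:R * 2) <= 2 * ln n%:R :> R.
  by rewrite lnM ?posrE//; lra.
have h : K * (gamma * D%:R) * ln (n%:R * 2) <= K * (gamma * D%:R) * (2 * ln n%:R).
  by rewrite ler_pM2l// mulr_gt0//; lra.
rewrite /x; lra.
Qed.
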